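(* Let $X$ be an infinite-dimensional complex Banach space and let $T\in\mathcal{B}(X)$. The following statements are equivalent: (i) $T$ satisfies property $(Z_{E_a})$; (ii) $T$ satisfies property $(gaw)$ and $\sigma_{BW}(T)=\sigma_{W}(T)$; (iii) $T$ satisfies property $(aw)$ and $E_a(T)=E_a^0(T)$; (iv) $T$ satisfies property $(Baw)$ and $E_a(T)=E_a^0(T)$.
   Context: $\mathcal{B}(X)$ is the algebra of bounded linear operators on $X$ and $I$ is the identity. For a bounded operator $S$, $\mathcal{N}(S)$ and $\mathcal{R}(S)$ are its null space and range, $\sigma(S)$ its spectrum, and $\sigma_a(S)$ its approximate point spectrum ($\lambda\in\sigma_a(S)$ iff $S-\lambda I$ is not bounded below). A bounded operator $S$ on a Banach space (possibly finite-dimensional) is Fredholm if $\dim\mathcal{N}(S)<\infty$ and $\operatorname{codim}\mathcal{R}(S)<\infty$, with index $\operatorname{ind}(S)=\dim\mathcal{N}(S)-\operatorname{codim}\mathcal{R}(S)$; it is Weyl if it is Fredholm of index $0$. The Weyl spectrum is $\sigma_W(T)=\{\lambda\in\mathbb{C}: T-\lambda I \text{ is not Weyl}\}$. An operator $S\in\mathcal{B}(X)$ is B-Weyl if for some integer $n\ge 0$ the range $\mathcal{R}(S^n)$ is closed and the restriction $S_{[n]}:\mathcal{R}(S^n)\to\mathcal{R}(S^n)$ of $S$ is Weyl. The B-Weyl spectrum is $\sigma_{BW}(T)=\{\lambda\in\mathbb{C}: T-\lambda I\text{ is not B-Weyl}\}$. $\mathrm{iso}\,A$ denotes the set of isolated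 points of $A\subset\mathbb{C}$. $\sigma_p(T)$ is the set of eigenvalues of $T$ and $\sigma_p^0(T)$ the set of eigenvalues $\lambda$ of $T$ of finite multiplicity ($0<\dim\mathcal{N}(T-\lambda I)<\infty$). Put $E_a(T)=\mathrm{iso}\,\sigma_a(T)\cap\sigma_p(T)$ and $E_a^0(T)=\mathrm{iso}\,\sigma_a(T)\cap\sigma_p^0(T)$. $T$ satisfies: property $(Z_{E_a})$ if $\sigma(T)\setminus\sigma_W(T)=E_a(T)$; property $(gaw)$ if $\sigma(T)\setminus\sigma_{BW}(T)=E_a(T)$; property $(aw)$ if $\sigma(T)\setminus\sigma_W(T)=E_a^0(T)$; property $(Baw)$ if $\sigma(T)\setminus\sigma_{BW}(T)=E_a^0(T)$. *)

(* Defs.v *)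
(* MathComp-Analysis: the complex numbers are R[i] for R : realType. *)
From HB Require Import structures.
From mathcomp Require Import all_boot all_order all_algebra.
From mathcomp Require Import complex.
From mathcomp Require Import all_classical all_reals all_analysis.

Set Implicit Arguments.
Unset Strict Implicit.
Unset Printing Implicit Defensive.

Import Order.TTheory GRing.Theory Num.Theory.
Import numFieldNormedType.Exports.

Local Open Scope classical_set_scope.
Local Open Scope ring_scope.
Local Open Scope complex_scope.

Section Dimension.
Variables (K : fieldType) (E : lmodType K).

(* dim (V / W) = n for subspaces W `<=` V: the classes of e_0, ..., e_(n-1)
   form a basis of the quotient space V / W *)
Definition dim_quotient (V W : set E) (n : nat) : Prop :=
  exists e : 'I_n -> E,
    [/\ forall i, V (e i),
        forall v, V v -> exists c : 'I_n -> K, W (v - \sum_i c i *: e i)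
      & forall c : 'I_n -> K, W (\sum_i c i *: e i) -> forall i, c i = 0].

Definition has_dim (V : set E) (n : nat) : Prop := dim_quotient V [set 0] n.

Definition finite_dim (V : set E) : Prop := exists n, has_dim V n.

Definition nullspace (S : E -> E) : set E := [set x | S x = 0].

(* In the next three definitions S maps the subspace V into itself, and it is
   the restriction S : V -> V that is Fredholm (of index k, resp. Weyl);
   V = setT gives the notions for S itself. The null space of the restriction is
   V `&` nullspace S and its range is S @` V. *)
Definition fredholm_on (V : set E) (S : E -> E) : Prop :=
  finite_dim (V `&` nullspace S) /\ exists b, dim_quotient V (S @` V) b.

Definition has_index_on (V : set E) (S : E -> E) (k : int) : Prop :=
  exists a b : nat, [/\ has_dim (V `&` nullspace S) a,
    dim_quotient V (S @` V) b & k = a%:Z - b%:Z].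

Definition weyl_on (V : set E) (S : E -> E) : Prop :=
  fredholm_on V S /\ has_index_on V S 0.

Definition weyl (S : E -> E) : Prop := weyl_on setT S.

End Dimension.

Section Spectra.
Variables (R : realType) (X : completeNormedModType R[i]).

Definition Bweyl (S : X -> X) : Prop :=
  exists n : nat, closed (range (iter n S)) /\ weyl_on (range (iter n S)) S.

(* For scalars c in R[i], 0 < c means that c is a positive real; norms of
   vectors of X are nonnegative reals of R[i]. *)
Definition bounded_below (S : X -> X) : Prop :=
  exists2 c : R[i], 0 < c & forall x, c * `|x| <= `|S x|.

(* invertible in the algebra of bounded linear operators *)
Definition invertible_op (S : X -> X) : Prop :=
  exists G : {linear X -> X}, [/\ continuous G, cancel S G & cancel G S].

(* T - l I *)
Definition op_shift (T : X -> X) (l : R[i]) : X -> X := fun x => T x - l *: x.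

Implicit Type T : X -> X.

Definition spectrum T : set R[i] := [set l | ~ invertible_op (op_shift T l)].

Definition approx_point_spectrum T : set R[i] :=
  [set l | ~ bounded_below (op_shift T l)].

Definition weyl_spectrum T : set R[i] := [set l | ~ weyl (op_shift T l)].

Definition Bweyl_spectrum T : set R[i] := [set l | ~ Bweyl (op_shift T l)].

Definition eigenvalues T : set R[i] :=
  [set l | exists2 x : X, x != 0 & T x = l *: x].

Definition eigenvalues_fin T : set R[i] :=
  [set l | exists2 n : nat, (0 < n)%N & has_dim (nullspace (op_shift T l)) n].

(* The topology of R[i] is the one given by the modulus, which the library
   attaches to the alias (R[i])^o. *)
Definition iso (A : set R[i]) : set R[i] := isolated (A : set (R[i])^o).

Definition Ea T : set R[i] := iso (approx_point_spectrum T) `&` eigenvalues T.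

Definition Ea0 T : set R[i] :=
  iso (approx_point_spectrum T) `&` eigenvalues_fin T.

Definition property_ZEa T : Prop := spectrum T `\` weyl_spectrum T = Ea T.

Definition property_gaw T : Prop := spectrum T `\` Bweyl_spectrum T = Ea T.

Definition property_aw T : Prop := spectrum T `\` weyl_spectrum T = Ea0 T.

Definition property_Baw T : Prop := spectrum T `\` Bweyl_spectrum T = Ea0 T.

End Spectra.

(* Main.v *)
Require Import Defs.
From HB Require Import structures.
From mathcomp Require Import all_boot all_order all_algebra.
From mathcomp Require Import complex.
From mathcomp Require Import all_classical all_reals all_analysis.
From mathcomp Require Import ring lra.
Import Order.TTheory GRing.Theory Num.Theory.
Import numFieldNormedType.Exports.
Local Open Scope classical_set_scope.
Local Open Scope ring_scope.
Local Open Scope complex_scope.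

(** The definitions reduce the three equivalences to two facts about
[S = T - l].

If [S] is B-Weyl and its null space is finite-dimensional, then [S] is Weyl
([Bweyl_finite_nullity]): the exact sequence [0 -> N /\ S V -> N /\ V ->
V / S V -> S V / S S V -> 0], with [N] the null space of [S], lets the index
climb from the range of [S ^ n] back to the whole space.

If [T] has property [(Z_Ea)] and [S] is B-Weyl with [l] in the spectrum, then
[l] is in [Ea T] ([ZEa_Bweyl_Ea]). That [l] is an eigenvalue is easy; isolation
is a punctured neighbourhood argument. For small nonzero [m], the operator
[S - m] is Weyl ([Bweyl_punctured_weyl]). Moreover, either no small nonzero [m]
is an eigenvalue of [S], or every small [m] is one ([punctured_dichotomy]). In
the first case [S - m] is injective and Weyl, hence invertible, so [l] is
isolated in the spectrum. In the second case a small nonzero [m] puts [l + m] in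
the spectrum and outside the Weyl spectrum, hence in [Ea T] by [(Z_Ea)], although
[l + m] is surrounded by eigenvalues: a contradiction.

Both facts on small [m] are proved on closed subspaces [Y]: the ranges of powers
of [S] and their intersection. They rest on one tool, successive approximation ([approx_solve]): an
equation that can be solved up to half of its right-hand side, with a bound on
the solution, can be solved. It gives the open mapping theorem
([open_mapping]), the stability of bounded surjectivity ([perturb_solve]) and
the boundedness of coordinates in finite dimension ([free_coord_bound]).
That [S - m] is Weyl on [Y] if [S] is ([weyl_on_perturb]) follows by bordering: adding
to [S] a map from [K ^ a] onto a complement of its range makes it onto with a
null space of dimension [a]; both properties persist for small [m], and they
imply that [S - m] is Weyl ([weyl_on_bordered]). *)

Set Implicit Arguments.
Unset Strict Implicit.
Unset Printing Implicit Defensive.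

(** * Subspaces and dimensions of quotients *)

Section Subspaces.
Variables (K : fieldType).
Implicit Types E F : lmodType K.

Definition is_subspace E (V : set E) : Prop :=
  V 0 /\ forall (a : K) u v, V u -> V v -> V (a *: u + v).

Lemma subspaceD E (V : set E) u v : is_subspace V -> V u -> V v -> V (u + v).
Proof. by move=> [_ VL] Vu Vv; rewrite -[u]scale1r; exact: VL. Qed.

Lemma subspaceZ E (V : set E) a u : is_subspace V -> V u -> V (a *: u).
Proof. by move=> [V0 VL] Vu; rewrite -[_ *: _]addr0; exact: VL. Qed.

Lemma subspaceN E (V : set E) u : is_subspace V -> V u -> V (- u).
Proof. by move=> sV Vu; rewrite -scaleN1r; exact: subspaceZ. Qed.

Lemma subspaceB E (V : set E) u v : is_subspace V -> V u -> V v -> V (u - v).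
Proof. by move=> sV Vu Vv; apply: subspaceD => //; exact: subspaceN. Qed.

Lemma subspace_sum E (V : set E) (I : Type) (r : seq I) (f : I -> E) :
  is_subspace V -> (forall i, V (f i)) -> V (\sum_(i <- r) f i).
Proof.
move=> sV Vf; elim/big_ind: _ => //; first by case: sV.
by move=> u v; exact: subspaceD.
Qed.

Lemma subspaceT E : is_subspace [set: E].
Proof. by []. Qed.

Lemma subspace0 E : is_subspace [set 0 : E].
Proof. by split=> // a u v -> ->; rewrite scaler0 addr0. Qed.

Lemma subspaceI E (V W : set E) :
  is_subspace V -> is_subspace W -> is_subspace (V `&` W).
Proof.
move=> [V0 VL] [W0 WL]; split=> // a u v [Vu Wu] [Vv Wv].
by split; [exact: VL | exact: WL].
Qed.

Lemma subspace_image E F (f : {linear E -> F}) (V : set E) :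
  is_subspace V -> is_subspace (f @` V).
Proof.
move=> [V0 VL]; split; first by exists 0; rewrite ?linear0.
by move=> a _ _ [u Vu <-] [v Vv <-]; exists (a *: u + v); [exact: VL|rewrite linearP].
Qed.

Lemma subspace_preimage E F (f : {linear E -> F}) (V : set F) :
  is_subspace V -> is_subspace (f @^-1` V).
Proof.
move=> [V0 VL]; split; rewrite /preimage /= ?linear0// => a u v Vu Vv.
by rewrite linearP; exact: VL.
Qed.

Lemma subspace_nullspace E (f : {linear E -> E}) : is_subspace (nullspace f).
Proof. exact: (subspace_preimage f (subspace0 E)). Qed.

Definition lincomb E n (e : 'I_n -> E) (c : 'rV[K]_n) : E :=
  \sum_i c 0 i *: e i.

Lemma lincomb_is_linear E n (e : 'I_n -> E) : linear (lincomb e).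
Proof.
move=> a u v; rewrite /lincomb scaler_sumr -big_split /=.
by apply: eq_bigr => i _; rewrite !mxE scalerDl scalerA.
Qed.

HB.instance Definition _ E n (e : 'I_n -> E) :=
  GRing.isLinear.Build K 'rV[K]_n E _ (lincomb e) (lincomb_is_linear e).

Lemma lincomb_row E n (e : 'I_n -> E) (c : 'I_n -> K) :
  lincomb e (\row_i c i) = \sum_i c i *: e i.
Proof. by apply: eq_bigr => i _; rewrite mxE. Qed.

Lemma lincomb_in E n (e : 'I_n -> E) c (V : set E) :
  is_subspace V -> (forall i, V (e i)) -> V (lincomb e c).
Proof.
by move=> sV Ve; apply: subspace_sum => // i; exact: subspaceZ.
Qed.

Lemma lincomb_mulmx E m n (e : 'I_n -> E) (P : 'M[K]_(m, n)) (t : 'rV[K]_m) :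
  lincomb e (t *m P) = \sum_j t 0 j *: lincomb e (row j P).
Proof.
rewrite mulmx_sum_row linear_sum.
by apply: eq_bigr => j _; rewrite linearZ.
Qed.

Definition lin_free E n (e : 'I_n -> E) : Prop :=
  forall c, lincomb e c = 0 -> c = 0.

Lemma has_dimP E (V : set E) n : is_subspace V -> 
  has_dim V n <-> exists e : 'I_n -> E, [/\ forall i, V (e i),
    forall v, V v -> exists c, v = lincomb e c & lin_free e].
Proof.
move=> sV; split=> -[e [Ve sp fr]]; exists e; split=> //.
- move=> v /sp [c /eqP]; rewrite subr_eq0 => /eqP ->.
  by exists (\row_i c i); rewrite lincomb_row.
- by move=> c c0; apply/rowP => i; rewrite mxE (fr (c 0)).
- by move=> v /sp [c ->]; exists (c 0); rewrite /= subrr.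
- move=> c; rewrite -lincomb_row => /fr /rowP c0 i.
  by have := c0 i; rewrite !mxE.
Qed.

(** Take a matrix of maximal rank among those whose row space stays in [U]. *)
Lemma row_space_of_subspace n (U : set 'rV[K]_n) : is_subspace U ->
  exists M : 'M[K]_n, forall c, U c <-> (c <= M)%MS.
Proof.
move=> [U0 UL].
pose P r := `[< exists2 M : 'M[K]_n, \rank M = r &
                  forall c : 'rV_n, (c <= M)%MS -> U c >].
have exP : exists r, P r.
  exists 0%N; apply/asboolP; exists 0; rewrite ?mxrank0// => c.
  by rewrite submx0 => /eqP ->.
have ubP r : P r -> (r <= n)%N by move=> /asboolP[M <- _]; exact: rank_leq_row.
case: (ex_maxnP exP ubP) => r /asboolP[M rM MU] rmax.
exists M => c; split; last exact: MU.
move=> Uc; apply: contrapT => /negP cM.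
have /rmax : P (\rank (M + c)%MS).
  apply/asboolP; exists (M + c)%MS => // d /sub_addsmxP[[u v] /= ->].
  rewrite addrC [v]mx11_scalar mul_scalar_mx; apply: UL => //.
  by apply: MU; rewrite submxMl.
rewrite leqNgt -rM => /negP; apply.
rewrite (ltn_leqif (mxrank_leqif_sup (addsmxSl M c))) addsmx_sub submx_refl /=.
exact: cM.
Qed.

(** The map [psi] identifies the row space of [M] modulo that of [M0] with
[V / W]; it sends a row basis of a complement of [M0] in [M] to a basis. *)
Lemma dim_quotient_coord E n (psi : {linear 'rV[K]_n -> E}) (M M0 : 'M[K]_n)
    (V W : set E) :
  is_subspace W -> (M0 <= M)%MS ->
  (forall c : 'rV_n, (c <= M)%MS -> V (psi c)) ->
  (forall v, V v -> exists2 c : 'rV_n, (c <= M)%MS & W (v - psi c)) ->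
  (forall c : 'rV_n, (c <= M)%MS -> W (psi c) <-> (c <= M0)%MS) ->
  dim_quotient V W (\rank M - \rank M0).
Proof.
move=> sW M0M psiV psiS psiW.
have <- : \rank (M :\: M0)%MS = (\rank M - \rank M0)%N.
  have := mxrank_cap_compl M M0.
  have /eqmxP/eqmx_rank -> := capmx_idPr M0M.
  by move=> <-; rewrite addKn.
set B := row_base (M :\: M0)%MS.
have BD : (B :=: M :\: M0)%MS := eq_row_base _.
have BM : (B <= M)%MS by rewrite BD diffmxSl.
have psiB (w : 'rV_ _) : \sum_i w 0 i *: psi (row i B) = psi (w *m B).
  by rewrite mulmx_sum_row linear_sum; apply: eq_bigr => i _; rewrite linearZ.
exists (fun i => psi (row i B)); split.
- by move=> i; apply: psiV; apply: submx_trans BM; exact: row_sub.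
- move=> v /psiS [c cM Wc].
  have : (c <= M0 + B)%MS.
    apply: submx_trans cM _; rewrite -(addsmx_diff_cap_eq M M0) addsmxC.
    by apply: addsmxS; [exact: capmxSr | rewrite BD].
  move=> /sub_addsmxP[[u w] /= cE].
  exists (w 0); rewrite psiB.
  have -> : v - psi (w *m B) = (v - psi c) + psi (u *m M0).
    by rewrite cE linearD opprD addrA addrAC subrK.
  apply: subspaceD => //; apply/psiW; last by rewrite submxMl.
  by apply: submx_trans M0M; rewrite submxMl.
- move=> c; have -> : \sum_i c i *: psi (row i B) = psi ((\row_i c i) *m B).
    by rewrite -psiB; apply: eq_bigr => i _; rewrite mxE.
  have cBM : ((\row_i c i) *m B <= M)%MS by apply: submx_trans BM; exact: submxMl.
  move=> /psiW -/(_ cBM) cM0 i.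
  have : ((\row_i c i) *m B <= (M :\: M0) :&: M0)%MS.
    by rewrite sub_capmx cM0 andbT -BD submxMl.
  rewrite capmx_diff submx0 => /eqP.
  have Bfree : row_free B by exact: row_base_free.
  rewrite -(mul0mx _ B) => /(row_free_inj Bfree) /rowP/(_ i).
  by rewrite !mxE.
Qed.
End Subspaces.

Section Dimensions.
Variables (K : fieldType).
Implicit Types E F : lmodType K.

Lemma has_dim_leq E (V : set E) a b (f : 'I_b -> E) : is_subspace V ->
  has_dim V a -> (forall j, V (f j)) -> lin_free f -> (b <= a)%N.
Proof.
move=> sV /(has_dimP _ sV)[e [_ sp _]] Vf ff.
have [P PE] : exists P : 'M[K]_(b, a), forall j, f j = lincomb e (row j P).
  have [g gE] := boolp.choice (fun j => sp _ (Vf j)).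
  exists (\matrix_j g j) => j; by rewrite rowK.
suff /eqP <- : row_free P by exact: rank_leq_col.
rewrite -kermx_eq0; apply/rowV0P => t /sub_kermxP tP0; apply: ff.
have := lincomb_mulmx e P t; rewrite tP0 linear0 => /esym eq0.
by apply: etrans eq0; apply: eq_bigr => j _; rewrite PE.
Qed.

Lemma has_dim_unique E (V : set E) a b : is_subspace V ->
  has_dim V a -> has_dim V b -> a = b.
Proof.
move=> sV Va Vb; apply/eqP; rewrite eqn_leq; apply/andP; split.
- by have /(has_dimP _ sV)[e [Ve _ fe]] := Va; apply: has_dim_leq Vb _ fe.
- by have /(has_dimP _ sV)[e [Ve _ fe]] := Vb; apply: has_dim_leq Va _ fe.
Qed.

Lemma subspace_coords E n (e : 'I_n -> E) (V : set E) : is_subspace V ->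
  exists M : 'M[K]_n, forall c, V (lincomb e c) <-> (c <= M)%MS.
Proof.
move=> sV.
have [M ME] := row_space_of_subspace (subspace_preimage (lincomb e) sV).
by exists M => c; rewrite -ME.
Qed.

Lemma has_dim_coords E n (e : 'I_n -> E) (M : 'M[K]_n) (V U : set E) :
  lin_free e -> (forall v, V v -> exists c, v = lincomb e c) ->
  (forall c, V (lincomb e c)) ->
  (forall c, U (lincomb e c) <-> (c <= M)%MS) -> has_dim (V `&` U) (\rank M).
Proof.
move=> fe sp Ve ME; rewrite -[\rank M]subn0 -(mxrank0 K n n).
apply: (dim_quotient_coord (psi := lincomb e)) => //.
- exact: subspace0.
- exact: sub0mx.
- by move=> c cM; split; [exact: Ve | exact: (ME c).2].
- move=> v [/sp[c ->] Uc]; exists c; first exact: (ME c).1.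
  by rewrite /= subrr.
- move=> c _; rewrite submx0; split=> [/fe ->//|/eqP ->].
  by rewrite /= linear0.
Qed.

Lemma finite_dim_sub E (V U : set E) : is_subspace V -> is_subspace U ->
  finite_dim V -> finite_dim (V `&` U).
Proof.
move=> sV sU [n /(has_dimP _ sV)[e [Ve sp fe]]].
have [M ME] := subspace_coords e sU.
by exists (\rank M); apply: has_dim_coords ME => // c; exact: lincomb_in.
Qed.

(** The hypotheses say that [f] induces an isomorphism from [V / W] to
[V1 / W1]; a basis is lifted along it. *)
Lemma dim_quotient_pullback E F (f : {linear E -> F}) (V W : set E)
    (V1 W1 : set F) n :
  is_subspace V -> is_subspace W1 ->
  (forall v, V v -> V1 (f v)) ->
  (forall v1, V1 v1 -> exists2 v, V v & W1 (v1 - f v)) ->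
  (forall v, V v -> W1 (f v) <-> W v) ->
  dim_quotient V1 W1 n -> dim_quotient V W n.
Proof.
move=> sV sW1 fV fS fW [e [Ve sp fr]].
have [g gP] : exists g : 'I_n -> E, forall i, V (g i) /\ W1 (e i - f (g i)).
  have gP i : exists x, V x /\ W1 (e i - f x).
    by have [v] := fS _ (Ve i); exists v.
  by have [g gE] := boolp.choice gP; exists g.
have Vg i : V (g i) by case: (gP i).
have Vcg c : V (\sum_i c i *: g i).
  by apply: subspace_sum => // i; exact: subspaceZ.
have ediff c : W1 (\sum_i c i *: e i - f (\sum_i c i *: g i)).
  rewrite linear_sum -sumrB; apply: subspace_sum => // i.
  by rewrite linearZ -scalerBr; apply: subspaceZ => //; case: (gP i).
exists g; split=> //.
- move=> v Vv; have [c Wc] := sp _ (fV _ Vv); exists c.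
  apply/fW; first exact: subspaceB.
  rewrite linearB -[X in X - _](subrK (\sum_i c i *: e i)) -addrA.
  exact: subspaceD.
- move=> c /fW -/(_ (Vcg c)) Wc; apply: fr.
  by rewrite -[X in W1 X](subrK (f (\sum_i c i *: g i))); exact: subspaceD.
Qed.

Lemma dim_quotient_chain E (V U W : set E) p q : is_subspace U ->
  U `<=` V -> W `<=` U ->
  dim_quotient V U p -> dim_quotient U W q -> dim_quotient V W (p + q).
Proof.
move=> sU UV WU [e [Ve spe fe]] [g [Ug spg fg]].
pose h (i : 'I_(p + q)) := match fintype.split i with inl j => e j | inr j => g j end.
have sumh (c : 'I_(p + q) -> K) : \sum_i c i *: h i =
    \sum_i c (lshift q i) *: e i + \sum_i c (rshift p i) *: g i.
  rewrite big_split_ord /=; congr (_ + _); apply: eq_bigr => i _; rewrite /h.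
  - by rewrite (unsplitK (inl i)).
  - by rewrite (unsplitK (inr i)).
have Ugc c : U (\sum_i c i *: g i).
  by apply: subspace_sum => // i; exact: subspaceZ.
exists h; split.
- by move=> i; rewrite /h; case: fintype.split => j //; exact: UV.
- move=> v /spe [c /spg [d Wd]].
  pose cd (i : 'I_(p + q)) := match fintype.split i with inl j => c j | inr j => d j end.
  exists cd; rewrite sumh opprD addrA.
  under eq_bigr do rewrite /cd (unsplitK (inl _)).
  by under [X in _ - X]eq_bigr do rewrite /cd (unsplitK (inr _)).
- move=> c; rewrite sumh => Wc.
  have c0 : forall i, c (lshift q i) = 0.
    apply: (fe (fun i => c (lshift q i))).
    rewrite -[X in U X](addrK (\sum_i c (rshift p i) *: g i)).
    by apply: subspaceB => //; exact: WU.
  have d0 : forall i, c (rshift p i) = 0.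
    apply: (fg (fun i => c (rshift p i))); move: Wc; rewrite big1 ?add0r//.
    by move=> i _; rewrite c0 scale0r.
  move=> i; rewrite -(fintype.splitK i); case: fintype.split => j /=; [exact: c0|exact: d0].
Qed.

(** Applied to [f = S], this carries finite codimension from [S V] in [V] to
[S S V] in [S V]. *)
Lemma dim_quotient_image E F (f : {linear E -> F}) (V W : set E)
    (V1 W1 : set F) n :
  is_subspace V1 -> is_subspace W1 ->
  (forall v, V v -> V1 (f v)) ->
  (forall v1, V1 v1 -> exists2 v, V v & v1 = f v) ->
  (forall v, W v -> W1 (f v)) ->
  dim_quotient V W n -> exists m, dim_quotient V1 W1 m.
Proof.
move=> sV1 sW1 fV fS fW [e [Ve sp _]].
pose psi := lincomb (f \o e).
have [M0 M0E] := subspace_coords (f \o e) sW1.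
exists (\rank (1%:M : 'M[K]_n) - \rank M0)%N.
apply: (dim_quotient_coord (psi := psi)) => //.
- exact: submx1.
- by move=> c _; apply: lincomb_in => // i; exact: fV.
- move=> v1 /fS [v /sp [c Wc] ->]; exists (\row_i c i); first exact: submx1.
  rewrite /= /psi lincomb_row; move: Wc => /fW; rewrite linearB linear_sum.
  by under eq_bigr do rewrite linearZ.
- by move=> c _; exact: M0E.
Qed.
End Dimensions.

(** * Weyl restrictions along the ranges of the powers *)

Section WeylAlgebra.
Variables (K : fieldType) (E : lmodType K).
Implicit Types (S : {linear E -> E}) (V : set E).

Lemma weyl_onP V (S : E -> E) : weyl_on V S <->
  exists n, has_dim (V `&` nullspace S) n /\ dim_quotient V (S @` V) n.
Proof.
split=> [[_ [a [b [Na Rb /esym /eqP]]]]|[n [Nn Rn]]].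
  by rewrite subr_eq0 => /eqP [ab]; exists a; rewrite {2}ab.
split; last by exists n, n; rewrite subrr.
by split; exists n.
Qed.

Lemma weyl_on_inj V S : is_subspace V -> weyl_on V S ->
  V `&` nullspace S `<=` [set 0] -> V `<=` S @` V.
Proof.
move=> sV /weyl_onP[n [Nn [e [Ve sp _]]]] N0 v /sp[c].
have sN := subspaceI sV (subspace_nullspace S).
move: Nn => /(has_dimP _ sN)[f [Nf _ ff]].
case: n e Ve sp c f Nf ff => [|n] e Ve sp c f Nf ff.
  by rewrite big_ord0 subr0.
have /rowP/(_ ord0) : (delta_mx 0 ord0 : 'rV[K]_n.+1) = 0.
  by apply: ff; apply: big1 => i _; rewrite (N0 _ (Nf i)) scaler0.
by rewrite !mxE !eqxx => /eqP; rewrite oner_eq0.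
Qed.

(** [V / (S - m) V] and [S V / (S - m) S V] are isomorphic through [S], and
the eigenvectors of a nonzero eigenvalue lie in the range: away from [0],
restricting to the range does not change the Weyl property. *)
Lemma weyl_on_image V S (B : {linear E -> E}) m : m != 0 ->
  is_subspace V -> S @` V `<=` V -> (forall x, B x = S x - m *: x) ->
  weyl_on (S @` V) B -> weyl_on V B.
Proof.
move=> m0 sV SV BE /weyl_onP[n [Nn Rn]]; apply/weyl_onP; exists n.
have SVV x : V x -> V (S x) by move=> Vx; apply: SV; exists x.
have BV x : V x -> V (B x).
  by move=> Vx; rewrite BE; apply: subspaceB => //; [exact: SVV|exact: subspaceZ].
split.
  suff <- : (S @` V) `&` nullspace B = V `&` nullspace B by [].
  apply/seteqP; split=> x [Vx Bx]; split=> //; first exact: SV.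
  exists (m^-1 *: x); first exact: subspaceZ.
  have /eqP := Bx; rewrite BE subr_eq0 => /eqP Sx.
  by rewrite linearZ /= Sx scalerA mulVf// scale1r.
have SB x : S (B x) = B (S x) by rewrite !BE linearB linearZ.
apply: (dim_quotient_pullback (f := S) _ _ _ _ _ Rn) => //.
- exact: subspace_image (subspace_image _ sV).
- move=> _ [v Vv <-]; exists v => //; rewrite subrr.
  by case: (subspace_image B (subspace_image S sV)).
- move=> v Vv; split=> [[_ [w Vw <-]]|[w Vw <-]]; last first.
    by exists (S w); [exists w|rewrite SB].
  move=> BSw; set d := v - B w.
  have Vd : V d by apply: subspaceB => //; exact: BV.
  have Sd : S d = 0 by rewrite linearB SB BSw subrr.
  exists (w - m^-1 *: d); first by apply: subspaceB => //; exact: subspaceZ.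
  rewrite linearB [B (_ *: d)]BE linearZ /= Sd scaler0 sub0r scalerA mulfV//.
  by rewrite scale1r opprK /d addrC subrK.
Qed.

(** Index count along [0 -> N /\ S V -> N /\ V -> V / S V -> S V / S S V -> 0],
where [N] is the null space of [S]. *)
Lemma weyl_on_preimage V S : is_subspace V -> S @` V `<=` V ->
  finite_dim (V `&` nullspace S) -> weyl_on (S @` V) S -> weyl_on V S.
Proof.
move=> sV SV [a Na] /weyl_onP[r [Nr Rr]]; apply/weyl_onP; exists a; split=> //.
have sN := subspace_nullspace S.
have sNV := subspaceI sV sN.
have sSV := subspace_image S sV.
have /(has_dimP _ sNV)[e [Ne sp fe]] := Na.
have [M0 M0E] := subspace_coords e sSV.
have Nc c : (V `&` nullspace S) (lincomb e c) by exact: lincomb_in.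
have rE : r = \rank M0.
  apply: (has_dim_unique (subspaceI sSV sN) Nr).
  rewrite (_ : _ `&` _ = V `&` nullspace S `&` (S @` V)); last first.
    apply/seteqP; split=> x; first by move=> [SVx Nx]; split=> //; split=> //; exact: SV.
    by move=> [[_ Nx] SVx]; split.
  exact: has_dim_coords M0E.
pose U : set E := [set x | V x /\ exists2 y, V y & S x = S (S y)].
have sU : is_subspace U.
  split; first by split; [case: sV|exists 0; [case: sV|rewrite !linear0]].
  move=> t u v [Vu [u1 Vu1 Su]] [Vv [v1 Vv1 Sv]]; split.
    by exact: (proj2 sV).
  exists (t *: u1 + v1); first by exact: (proj2 sV).
  by rewrite !linearP Su Sv.
have ra : (r <= a)%N by rewrite rE; exact: rank_leq_row.
rewrite -(subnKC ra); apply: (dim_quotient_chain (U := U)) => //.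
- by move=> x [].
- move=> _ [y Vy <-]; split; first by apply: SV; exists y.
  by exists y.
- apply: (dim_quotient_pullback (f := S) _ _ _ _ _ Rr) => //.
  + exact: subspace_image.
  + move=> _ [v Vv <-]; exists v => //; rewrite subrr.
    by case: (subspace_image S sSV).
  + move=> v Vv; split=> [[_ [w Vw <-] E1]|[_ [w Vw E1]]].
      by split=> //; exists w.
    by exists (S w); [exists w|].
- rewrite rE -{1}(mxrank1 K a).
  apply: (dim_quotient_coord (psi := lincomb e)) => //.
  + exact: submx1.
  + move=> c _; have [Vc Sc] := Nc c; split=> //; exists 0; first by case: sV.
    by rewrite !linear0.
  + move=> v [Vv [y Vy Sv]].
    have SyV : V (S y) by apply: SV; exists y.
    have [|c cE] := sp (v - S y).
      split; first exact: subspaceB.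
      by rewrite /nullspace /= linearB Sv subrr.
    exists c; first exact: submx1.
    by exists y => //; rewrite /= -cE opprB addrC subrK.
  + by move=> c _; exact: M0E.
Qed.
End WeylAlgebra.

(** * Bordered operators *)

Section Bordering.
Variables (K : fieldType) (E : lmodType K) (a : nat).
Implicit Types (B : {linear E -> E}) (Y : set E) (e : 'I_a -> E).

Definition bordered (B : E -> E) e (p : E * 'rV[K]_a) : E :=
  B p.1 + lincomb e p.2.

Lemma bordered_is_linear B e : linear (bordered B e).
Proof.
move=> t [u c] [v d]; rewrite /bordered /= !linearP /=.
by rewrite scalerDr addrACA.
Qed.

HB.instance Definition _ B e :=
  GRing.isLinear.Build K (E * 'rV[K]_a)%type E _ (bordered B e)
    (bordered_is_linear B e).

(** Let the rows of the square matrix [C] be the second components of a basis of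
the null space of the bordered operator. The null space of [B] is then
isomorphic to the left kernel of [C], and the cokernel of [B] to the quotient of
[K ^ a] by the row space of [C]: both have dimension [a - \rank C]. *)
Lemma weyl_on_bordered Y B e : is_subspace Y -> B @` Y `<=` Y ->
  (forall i, Y (e i)) ->
  (forall w, Y w -> exists2 p, Y p.1 & bordered B e p = w) ->
  has_dim [set p | Y p.1 /\ bordered B e p = 0] a -> weyl_on Y B.
Proof.
move=> sY BY Ye surj Kdim.
have sK : is_subspace [set p | Y p.1 /\ bordered B e p = 0].
  split; first by split; [case: sY|rewrite linear0].
  move=> t u v [Yu u0] [Yv v0]; split; first exact: (proj2 sY).
  by rewrite linearP /= u0 v0 scaler0 addr0.
have /(has_dimP _ sK)[k [Kk sp fk]] := Kdim.
pose y j := (k j).1; pose C : 'M[K]_a := \matrix_j (k j).2.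
have kE t : lincomb k t = (lincomb y t, t *m C).
  rewrite [LHS]surjective_pairing /lincomb; congr pair.
    by rewrite (big_morph (fun p => p.1) (id1 := 0) (op1 := +%R)).
  rewrite (big_morph (fun p => p.2) (id1 := 0) (op1 := +%R))// mulmx_sum_row.
  by apply: eq_bigr => i _; rewrite rowK.
have Yy t : Y (lincomb y t).
  by apply: lincomb_in => // j; case: (Kk j).
have kerP v c : Y v -> B v = - lincomb e c ->
    exists t, v = lincomb y t /\ c = t *m C.
  move=> Yv Bv; have [|t] := sp (v, c).
    by split=> //; rewrite /bordered /= Bv addNr.
  by rewrite kE => -[-> ->]; exists t.
have ByE t : B (lincomb y t) = - lincomb e (t *m C).
  apply/eqP; rewrite -addr_eq0; apply/eqP.
  have [_] : [set p | Y p.1 /\ bordered B e p = 0] (lincomb k t).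
    exact: lincomb_in.
  by rewrite kE.
apply/weyl_onP; exists (a - \rank C)%N; split.
- rewrite -mxrank_ker -[\rank _]subn0 -(mxrank0 K a a).
  apply: (dim_quotient_coord (psi := lincomb y)) => //.
  + exact: subspace0.
  + exact: sub0mx.
  + move=> c /sub_kermxP cC; split; first exact: Yy.
    by rewrite /nullspace /= ByE cC linear0 oppr0.
  + move=> v [Yv Bv]; have [|t [vE tC]] := kerP v 0 Yv.
      by rewrite linear0 oppr0.
    exists t; first by apply/sub_kermxP.
    by rewrite /= vE subrr.
  + move=> c /sub_kermxP cC; rewrite submx0; split=> [c0|/eqP ->].
      by apply/eqP/fk; rewrite kE cC; congr pair.
    by rewrite /= linear0.
- rewrite -[X in (X - _)%N](mxrank1 K a).
  apply: (dim_quotient_coord (psi := lincomb e)) => //.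
  + exact: subspace_image.
  + exact: submx1.
  + by move=> c _; exact: lincomb_in.
  + move=> w /surj [[v c] /= Yv <-]; exists c; first exact: submx1.
    by exists v => //; rewrite /bordered /= addrK.
  + move=> c _; split=> [[v Yv Bv]|/submxP[t ->]].
      have [||t [_ ->]] := kerP (- v) c; last exact: submxMl.
        exact: subspaceN.
      by rewrite linearN Bv.
    exists (- lincomb y t); first exact: subspaceN.
    by rewrite linearN ByE opprK.
Qed.
End Bordering.

(** * Successive approximation and the open mapping theorem *)

Section RealNorm.
Variable R : realType.

(** Norms over [R[i]] take values in a partially ordered field; the real part
gives the same number in the totally ordered field [R]. *)
Definition rnorm (V : normedZmodType R[i]) (x : V) : R := complex.Re `|x|.

Lemma rnormE (V : normedZmodType R[i]) (x : V) : (rnorm x)%:C = `|x|.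
Proof. by apply: RRe_real; exact: normr_real. Qed.

Lemma rnorm_ge0 (V : normedZmodType R[i]) (x : V) : 0 <= rnorm x.
Proof. by rewrite -ler0c rnormE. Qed.

Lemma le_rnormD (V : normedZmodType R[i]) (x y : V) :
  rnorm (x + y) <= rnorm x + rnorm y.
Proof. by rewrite -lecR rmorphD /= !rnormE ler_normD. Qed.

Lemma rnormZ (V : normedModType R[i]) (c : R[i]) (x : V) :
  rnorm (c *: x) = rnorm c * rnorm x.
Proof. by apply: (@complexI R); rewrite rmorphM /= !rnormE normrZ. Qed.

Lemma rnormM (c d : R[i]) : rnorm (c * d) = rnorm c * rnorm d.
Proof. by apply: (@complexI R); rewrite rmorphM /= !rnormE normrM. Qed.

Lemma rnorm0_eq0 (V : normedZmodType R[i]) (x : V) : rnorm x = 0 -> x = 0.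
Proof. by move=> x0; apply/eqP; rewrite -normr_eq0 -rnormE x0. Qed.

Lemma rnorm_gt0 (V : normedZmodType R[i]) (x : V) : (0 < rnorm x) = (x != 0).
Proof. by rewrite -(ltcR 0) rnormE normr_gt0. Qed.

Lemma rnorm_real (x : R) : rnorm x%:C = `|x|.
Proof.
by apply: (@complexI R); rewrite rnormE normc_def /= expr0n /= addr0 sqrtr_sqr.
Qed.

Lemma rnorm_nonneg (x : R) : 0 <= x -> rnorm x%:C = x.
Proof. by move=> x0; rewrite rnorm_real ger0_norm. Qed.

Lemma complex_pos_real (e : R[i]) : 0 < e -> exists2 r : R, 0 < r & e = r%:C.
Proof.
move=> e0; have eE : (complex.Re e)%:C = e by apply: RRe_real; exact: gtr0_real.
by exists (complex.Re e); rewrite ?eE// -(ltcR 0) eE.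
Qed.
End RealNorm.

Section Seminorms.
Variable R : realType.
Implicit Types D Z : lmodType R[i].

Definition seminorm D (p : D -> R) : Prop :=
  (forall x y, p (x + y) <= p x + p y) /\
  (forall (c : R[i]) x, p (c *: x) = rnorm c * p x).

Lemma rnorm_seminorm (X : normedModType R[i]) : seminorm (@rnorm R X).
Proof. by split; [exact: le_rnormD|exact: rnormZ]. Qed.

Lemma seminorm0 D (p : D -> R) : seminorm p -> p 0 = 0.
Proof.
by move=> [_ pZ]; rewrite -(scale0r 0) pZ (rnorm_nonneg (lexx 0)) mul0r.
Qed.

Lemma seminormN D (p : D -> R) x : seminorm p -> p (- x) = p x.
Proof.
by move=> [_ pZ]; rewrite -scaleN1r pZ -(rmorphN1 (real_complex R)) rnorm_real normrN1 mul1r.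
Qed.

Lemma seminormB D (p : D -> R) x y : seminorm p -> p (x - y) = p (y - x).
Proof. by move=> sp; rewrite -opprB seminormN. Qed.

Lemma seminorm_ge0 D (p : D -> R) x : seminorm p -> 0 <= p x.
Proof.
move=> sp; have := sp.1 x (- x); rewrite subrr (seminorm0 sp) seminormN//.
lra.
Qed.

Lemma half_exp_small (M e : R) : 0 < e -> exists n, M * 2^-1 ^+ n < e.
Proof.
move=> e0; exists (Num.Def.archi_bound (`|M| / e)).
set n := Num.Def.archi_bound _.
have Mn : `|M| / e < n%:R by apply: archi_boundP; rewrite divr_ge0// ltW.
rewrite exprVn ltr_pdivrMr ?exprn_gt0//.
apply: le_lt_trans (ler_norm M) _.
move: Mn; rewrite ltr_pdivrMr// mulrC => /lt_le_trans; apply.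
by rewrite ler_pM2l// -natrX ler_nat ltnW// ltn_expl.
Qed.

Lemma le_half_exp (x y M : R) : (forall n, x <= y + M * 2^-1 ^+ n) -> x <= y.
Proof.
move=> xM; apply/ler_addgt0Pr => e e0; have [n Mn] := half_exp_small M e0.
by apply: le_trans (xM n) _; rewrite lerD2l ltW.
Qed.

(** This form of completeness suits successive approximation, and it is stated
for a seminorm on a bare module so as to cover product spaces without putting a
topology on them. *)
Definition geom_complete D (p : D -> R) (V : set D) : Prop :=
  forall (u : nat -> D) (M : R), (forall k, V (u k)) ->
    (forall k, p (u k) <= M * 2^-1 ^+ k) ->
  exists2 s, V s &
    forall n, p (s - \sum_(k < n) u k) <= 2 * M * 2^-1 ^+ n.

Lemma partial_sum_dist D (p : D -> R) (u : nat -> D) M n m : seminorm p ->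
  (forall k, p (u k) <= M * 2^-1 ^+ k) ->
  p (\sum_(k < n + m) u k - \sum_(k < n) u k) <= 2 * M * 2^-1 ^+ n.
Proof.
move=> sp uM.
have M0 : 0 <= M.
  by have := le_trans (seminorm_ge0 (u 0%N) sp) (uM 0%N); rewrite expr0 mulr1.
suff : p (\sum_(k < n + m) u k - \sum_(k < n) u k) <=
    2 * M * 2^-1 ^+ n - 2 * M * 2^-1 ^+ (n + m).
  by move=> /le_trans; apply; rewrite gerBl !mulr_ge0// exprn_ge0// invr_ge0.
elim: m => [|m IHm]; first by rewrite addn0 !subrr seminorm0.
rewrite addnS big_ord_recr /= addrAC.
apply: le_trans (sp.1 _ _) _; apply: le_trans (lerD IHm (uM _)) _.
rewrite exprS; lra.
Qed.

(** Any geometric rate of convergence implies the one required, by comparing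
with partial sums. *)
Lemma geom_completeW D (p : D -> R) (V : set D) : seminorm p ->
  (forall (u : nat -> D) (M : R), (forall k, V (u k)) ->
     (forall k, p (u k) <= M * 2^-1 ^+ k) ->
     exists s M', V s /\
       forall n, p (s - \sum_(k < n) u k) <= M' * 2^-1 ^+ n) ->
  geom_complete p V.
Proof.
move=> sp H u M Vu uM; have [s [M' [Vs sM']]] := H u M Vu uM.
exists s => // n; apply: (le_half_exp (M := M' * 2^-1 ^+ n)) => m.
have := sp.1 (s - \sum_(k < n + m) u k) (\sum_(k < n + m) u k - \sum_(k < n) u k).
rewrite addrA subrK => /le_trans; apply; rewrite addrC.
apply: lerD; first exact: (partial_sum_dist n m sp uM).
by rewrite -mulrA -exprD; exact: sM'.
Qed.

(** Solve in turn for the residuals: each is at most half of the previous one, so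
the partial solutions are dominated by a geometric series. *)
Lemma approx_solve D Z (p : D -> R) (q : Z -> R) (V : set D) (W : set Z)
    (L : {linear D -> Z}) (B C : R) :
  seminorm p -> seminorm q -> (forall z, q z = 0 -> z = 0) ->
  is_subspace W -> geom_complete p V ->
  (forall v, V v -> W (L v)) ->
  0 <= B -> (forall v, q (L v) <= B * p v) ->
  0 <= C -> (forall w, W w -> exists v,
    [/\ V v, p v <= C * q w & q (w - L v) <= 2^-1 * q w]) ->
  forall w, W w -> exists v, [/\ V v, L v = w & p v <= 2 * C * q w].
Proof.
move=> sp sq q0 sW cV LW B0 LB C0 appr w Ww.
have appr' x : exists v, W x -> [/\ V v, p v <= C * q x & q (x - L v) <= 2^-1 * q x].
  by have [/appr[v vP]|nW] := pselect (W x); [exists v|exists 0].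
have [g gP] := boolp.choice appr'.
pose r k := iter k (fun x => x - L (g x)) w.
have Wr k : W (r k).
  elim: k => //= k IHk; apply: subspaceB => //.
  by apply: LW; have [] := gP _ IHk.
have qr k : q (r k) <= q w * 2^-1 ^+ k.
  elim: k => [|k IHk]; first by rewrite expr0 mulr1.
  have [_ _] := gP _ (Wr k); move/le_trans; apply.
  by rewrite exprS mulrCA ler_pM2l// invr_gt0.
have [||s Vs sP] := cV (fun k => g (r k)) (C * q w).
- by move=> k; have [] := gP _ (Wr k).
- move=> k; have [_ + _] := gP _ (Wr k); move/le_trans; apply.
  by rewrite -mulrA ler_wpM2l.
have rE n : L (\sum_(k < n) g (r k)) = w - r n.
  rewrite linear_sum; elim: n => [|n IHn]; first by rewrite big_ord0 subrr.
  by rewrite big_ord_recr /= IHn opprB addrA addrAC.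
exists s; split=> //; last first.
  by have := sP 0%N; rewrite big_ord0 subr0 expr0 mulr1 mulrA.
apply/eqP; rewrite -subr_eq0; apply/eqP/q0/eqP.
rewrite eq_le seminorm_ge0// andbT.
apply: (le_half_exp (M := B * (2 * (C * q w)) + q w)) => n; rewrite add0r.
have -> : L s - w = L (s - \sum_(k < n) g (r k)) - r n.
  by rewrite linearB rE opprB addrA addrAC addrK.
apply: le_trans (sq.1 _ _) _; rewrite mulrDl; apply: lerD.
  by apply: le_trans (LB _) _; rewrite -mulrA ler_wpM2l.
by rewrite seminormN.
Qed.

(** A bounded solution for [L] solves the equation for [L'] up to half of its
right-hand side, so successive approximation applies. *)
Lemma perturb_solve D Z (p : D -> R) (q : Z -> R) (V : set D) (W : set Z)
    (L L' : {linear D -> Z}) (B C : R) :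
  seminorm p -> seminorm q -> (forall z, q z = 0 -> z = 0) ->
  is_subspace W -> geom_complete p V ->
  (forall v, V v -> W (L' v)) ->
  0 <= B -> (forall v, q (L' v) <= B * p v) ->
  0 < C -> (forall w, W w -> exists v, [/\ V v, L v = w & p v <= C * q w]) ->
  (forall v, V v -> 2 * C * q (L v - L' v) <= p v) ->
  forall w, W w -> exists v, [/\ V v, L' v = w & p v <= 2 * C * q w].
Proof.
move=> sp sq q0 sW cV LW B0 LB C0 solve LL'.
apply: (approx_solve (B := B)) => //; first exact: ltW.
move=> w Ww.
have [v [Vv Lv pv]] := solve w Ww; exists v; split=> //.
have := le_trans (LL' v Vv) pv; rewrite Lv.
by rewrite -mulrA mulrCA ler_pM2l// => ?; lra.
Qed.

(** Open mapping theorem, by a gliding hump: if no bound worked, there would be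
unit vectors [w_k] far from the image of ever larger balls, and
[\sum 8^-k w_k], where each ball is chosen after the previous terms, would have
no preimage. *)
Lemma open_mapping D Z (p : D -> R) (q : Z -> R) (V : set D) (W : set Z)
    (L : {linear D -> Z}) (B : R) :
  seminorm p -> seminorm q -> (forall z, q z = 0 -> z = 0) ->
  is_subspace V -> is_subspace W -> geom_complete p V -> geom_complete q W ->
  (forall v, V v -> W (L v)) ->
  0 <= B -> (forall v, q (L v) <= B * p v) ->
  (forall w, W w -> exists2 v, V v & L v = w) ->
  exists2 C, 0 < C &
    forall w, W w -> exists v, [/\ V v, L v = w & p v <= C * q w].
Proof.
move=> sp sq q0 sV sW cV cW LW B0 LB surj.
suff [C C0 appr] : exists2 C, 0 <= C & forall w, W w -> exists v,
    [/\ V v, p v <= C * q w & q (w - L v) <= 2^-1 * q w].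
  exists (2 * C + 1); first by rewrite ltr_wpDl// mulr_ge0.
  move=> w Ww.
  have [v [Vv Lv pv]] := approx_solve sp sq q0 sW cV LW B0 LB C0 appr Ww.
  exists v; split=> //; apply: le_trans pv _.
  by rewrite ler_wpM2r ?seminorm_ge0// lerDl.
apply: contrapT => nC.
have bad M : exists w, 0 <= M -> [/\ W w, q w = 1 &
    forall v, V v -> p v <= M -> 2^-1 < q (w - L v)].
  have [M0|M0] := pselect (0 <= M); last by exists 0.
  have [w [Ww qw far]] : exists w, [/\ W w, 0 < q w &
      forall v, V v -> p v <= M * q w -> 2^-1 * q w < q (w - L v)].
    apply: contrapT => nw; apply: nC; exists M => // w Ww.
    have [qw0|qw0] := eqVneq (q w) 0.
      exists 0; rewrite linear0 (seminorm0 sp) subr0 qw0 !mulr0.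
      by split=> //; case: sV.
    apply: contrapT => nv; apply: nw; exists w; split=> //.
      by rewrite lt_neqAle eq_sym qw0 seminorm_ge0.
    move=> v Vv pv; rewrite ltNge; apply/negP => qv; apply: nv.
    by exists v.
  exists ((q w)^-1%:C *: w) => _; split; first exact: subspaceZ.
    by rewrite sq.2 rnorm_nonneg ?invr_ge0 ?ltW// mulVf// gt_eqF.
  move=> v Vv pv; have qwn := rnorm_nonneg (ltW qw).
  have qwV : 0 <= (q w)^-1 by rewrite invr_ge0 ltW.
  have pqv : p ((q w)%:C *: v) <= M * q w.
    by rewrite sp.2 qwn mulrC ler_pM2r.
  have -> : (q w)^-1%:C *: w - L v = (q w)^-1%:C *: (w - L ((q w)%:C *: v)).
    rewrite linearZ /= scalerBr scalerA -rmorphM mulVf ?gt_eqF//.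
    by rewrite rmorph1 scale1r.
  rewrite sq.2 rnorm_nonneg// mulrC ltr_pdivlMr//.
  by apply: far pqv; exact: subspaceZ.
have [f fP] := boolp.choice bad.
have [g gP] : exists g : Z -> D, forall w, W w -> V (g w) /\ L (g w) = w.
  have H w : exists v, W w -> V v /\ L v = w.
    by have [/surj[v]|nW] := pselect (W w); [exists v|exists 0].
  by have [g gE] := boolp.choice H; exists g.
pose t : R := 8^-1.
have t0 : 0 < t by rewrite invr_gt0.
have tn0 n : 0 < t ^+ n by rewrite exprn_gt0.
pose N k (d : D) := (p d + k%:R) / t ^+ k.
have N0 k d : 0 <= N k d by rewrite divr_ge0 ?addr_ge0 ?seminorm_ge0// ltW.
pose d := fix d k := if k is k'.+1
  then d k' + (t ^+ k')%:C *: g (f (N k' (d k'))) else 0.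
pose h k := f (N k (d k)).
have hP k : [/\ W (h k), q (h k) = 1 &
    forall v, V v -> p v <= N k (d k) -> 2^-1 < q (h k - L v)].
  exact: fP.
pose u k := (t ^+ k)%:C *: h k.
have Wu k : W (u k) by apply: subspaceZ => //; case: (hP k).
have qu k : q (u k) = t ^+ k.
  by rewrite sq.2 rnorm_nonneg ?ltW//; case: (hP k) => _ -> _; rewrite mulr1.
have Vd k : V (d k).
  elim: k => [|k IHk] /=; first by case: sV.
  apply: subspaceD => //; apply: subspaceZ => //.
  by have [Wh _ _] := hP k; case: (gP _ Wh).
have Ld k : L (d k) = \sum_(j < k) u j.
  elim: k => [|k IHk]; first by rewrite big_ord0 linear0.
  rewrite big_ord_recr /= -IHk linearD linearZ /=; congr (_ + _ *: _).
  by have [Wh _ _] := hP k; case: (gP _ Wh).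
have [|s Ws sP] := cW u 1 Wu.
  move=> k; rewrite qu mul1r lerXn2r ?nnegrE ?invr_ge0// ?lef_pV2 ?posrE//.
  by rewrite ler_nat.
have tail k m : q (\sum_(j < k + m) u j - \sum_(j < k) u j) <= 2 * t ^+ k - 2 * t ^+ (k + m).
  elim: m => [|m IHm]; first by rewrite addn0 !subrr seminorm0.
  rewrite addnS big_ord_recr /= addrAC; apply: le_trans (sq.1 _ _) _.
  rewrite qu exprS; apply: le_trans (lerD IHm (lexx _)) _.
  by have := tn0 (k + m)%N; rewrite /t; lra.
have stail k : q (s - \sum_(j < k) u j) <= 2 * t ^+ k.
  apply: (le_half_exp (M := 2)) => m.
  have := sq.1 (s - \sum_(j < k + m) u j) (\sum_(j < k + m) u j - \sum_(j < k) u j).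
  rewrite addrA subrK => /le_trans; apply; rewrite addrC; apply: lerD.
    by apply: le_trans (tail k m) _; rewrite gerBl mulr_ge0// ltW.
  apply: le_trans (sP (k + m)%N) _; rewrite mulr1 ler_pM2l//.
  by rewrite exprD ler_piMl ?exprn_ge0 ?invr_ge0// exprn_ile1 ?invr_ge0// invf_le1// ler1n.
have [Vv Lv] := gP s Ws; set v := g s in Vv Lv.
have [k pvk] : exists k : nat, p v <= k%:R.
  by exists (Num.Def.archi_bound (p v)); apply/ltW/archi_boundP/seminorm_ge0.
have [_ _ far] := hP k.
have tk0 : 0 <= (t ^+ k)^-1 by rewrite invr_ge0 ltW.
have Vx : V ((t ^+ k)^-1%:C *: (v - d k)).
  by apply: subspaceZ => //; exact: subspaceB.
have px : p ((t ^+ k)^-1%:C *: (v - d k)) <= N k (d k).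
  rewrite sp.2 rnorm_nonneg// /N mulrC ler_pM2r ?invr_gt0//.
  apply: le_trans (sp.1 _ _) _; rewrite seminormN// addrC.
  by rewrite lerD2l.
have := far _ Vx px.
have -> : h k - L ((t ^+ k)^-1%:C *: (v - d k)) =
    (t ^+ k)^-1%:C *: (\sum_(j < k.+1) u j - s).
  have -> : L ((t ^+ k)^-1%:C *: (v - d k)) = (t ^+ k)^-1%:C *: (s - L (d k)).
    by rewrite linearZ linearB Lv.
  rewrite Ld big_ord_recr /=.
  rewrite [in RHS]addrAC [RHS]scalerDr.
  rewrite [_ *: u k]scalerA -rmorphM mulVf ?gt_eqF// rmorph1 scale1r [RHS]addrC.
  by rewrite -scalerN opprB.
rewrite sq.2 rnorm_nonneg// seminormB// => lt2.
have := lt_le_trans lt2 (ler_wpM2l tk0 (stail k.+1)).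
rewrite exprS mulrCA [_^-1 * _]mulrC mulrA mulrA mulfK ?gt_eqF//.
rewrite /t; lra.
Qed.
End Seminorms.

(** * Completeness of closed subspaces and of their products with rows *)

Section Completeness.

Lemma geometric_limit (F : numFieldType) (X : completeNormedModType F)
    (Y : set X) (u : nat -> X) (M : F) :
  closed Y -> (forall e : F, 0 < e -> exists n, 2 * M * 2^-1 ^+ n < e) ->
  (forall n, Y (\sum_(k < n) u k)) ->
  (forall n m, `|\sum_(k < n + m) u k - \sum_(k < n) u k| <= 2 * M * 2^-1 ^+ n) ->
  exists2 s, Y s & forall n, `|s - \sum_(k < n) u k| <= 2 * M * 2^-1 ^+ n.
Proof.
move=> cY small Yu dist; pose S n := \sum_(k < n) u k.
have /cauchy_cvgP cS : cauchy (S @ \oo).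
  apply: cauchy_exP => e e0; have [n ne] := small e e0; exists (S n).
  exists n => // m /= nm; rewrite -ball_normE /ball_ /= distrC.
  by apply: le_lt_trans ne; rewrite -(subnKC nm); exact: dist.
exists (lim (S @ \oo)).
  have Ynear : \forall n \near \oo, Y (S n) by exact: nearW.
  exact: (@closed_cvg _ _ \oo _ S Y cY Ynear _ cS).
move=> n; apply/ler_addgt0Pr => e e0.
have /cvgrPdist_lt/(_ e e0)[m _ mP] := cS.
have := ler_normD (lim (S @ \oo) - S (n + m)%N) (S (n + m)%N - S n).
rewrite addrA subrK => /le_trans; apply; rewrite [leRHS]addrC; apply: lerD.
  by apply: ltW; apply: mP; rewrite /= leq_addl.
exact: dist.
Qed.

Variable R : realType.

Lemma geom_complete_closed (X : completeNormedModType R[i]) (Y : set X) :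
  is_subspace Y -> closed Y -> geom_complete (@rnorm R X) Y.
Proof.
move=> sY cY u M Yu uM.
have [|||s Ys sP] := @geometric_limit _ X Y u M%:C cY.
- move=> e /complex_pos_real[r r0 ->]; have [n nr] := half_exp_small (2 * M) r0.
  by exists n; rewrite -ltcR !(rmorphM, rmorphXn, fmorphV, rmorph_nat) /= in nr *.
- by move=> n; exact: subspace_sum.
- move=> n m; have := partial_sum_dist n m (rnorm_seminorm X) uM.
  by rewrite -lecR rnormE !(rmorphM, rmorphXn, fmorphV, rmorph_nat).
exists s => // n; have := sP n.
by rewrite -lecR rnormE !(rmorphM, rmorphXn, fmorphV, rmorph_nat).
Qed.

Lemma real_geometric_limit (u : nat -> R) (M : R) :
  (forall k, `|u k| <= M * 2^-1 ^+ k) ->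
  exists s, forall n, `|s - \sum_(k < n) u k| <= 2 * M * 2^-1 ^+ n.
Proof.
move=> uM; have [||//|s _ sP] := @geometric_limit R R^o setT u M closedT.
- by move=> e e0; exact: half_exp_small.
- by [].
- move=> n m.
  have sC : seminorm (fun z : R[i]^o => rnorm (z : R[i])).
    by split; [exact: le_rnormD|exact: rnormM].
  have := @partial_sum_dist R _ _ (fun k => (u k)%:C : R[i]^o) M n m sC.
  rewrite -!rmorph_sum -rmorphB rnorm_real; apply=> k.
  by rewrite rnorm_real.
by exists s.
Qed.

Lemma rnorm_def (z : R[i]) :
  rnorm z = Num.sqrt (complex.Re z ^+ 2 + complex.Im z ^+ 2).
Proof. by rewrite /rnorm normc_def. Qed.

Lemma rnorm_complex_le (z : R[i]) : rnorm z <= `|complex.Re z| + `|complex.Im z|.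
Proof.
rewrite rnorm_def -[leRHS]ger0_norm ?addr_ge0// -sqrtr_sqr ler_wsqrtr//.
rewrite sqrrD !real_normK ?num_real// -addrA lerD2l lerDr.
by rewrite mulrn_wge0// mulr_ge0.
Qed.

Lemma Re_le_rnorm (z : R[i]) : `|complex.Re z| <= rnorm z.
Proof. by rewrite rnorm_def -sqrtr_sqr ler_wsqrtr// lerDl sqr_ge0. Qed.

Lemma Im_le_rnorm (z : R[i]) : `|complex.Im z| <= rnorm z.
Proof. by rewrite rnorm_def -sqrtr_sqr ler_wsqrtr// lerDr sqr_ge0. Qed.

Lemma complex_geometric_limit (u : nat -> R[i]) (M : R) :
  (forall k, rnorm (u k) <= M * 2^-1 ^+ k) ->
  exists s, forall n, rnorm (s - \sum_(k < n) u k) <= 4 * M * 2^-1 ^+ n.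
Proof.
move=> uM.
have [k|x xP] := @real_geometric_limit (fun k => complex.Re (u k)) M.
  exact: le_trans (Re_le_rnorm _) (uM k).
have [k|y yP] := @real_geometric_limit (fun k => complex.Im (u k)) M.
  exact: le_trans (Im_le_rnorm _) (uM k).
exists (Complex x y) => n; apply: le_trans (rnorm_complex_le _) _.
have -> : 4 * M * 2^-1 ^+ n = 2 * M * 2^-1 ^+ n + 2 * M * 2^-1 ^+ n by ring.
by apply: lerD; rewrite raddfB raddf_sum.
Qed.

Definition row_norm a (c : 'rV[R[i]]_a) : R := \sum_i rnorm (c 0 i).

Lemma row_norm_seminorm a : seminorm (@row_norm a).
Proof.
split=> [x y|c x]; rewrite /row_norm.
  rewrite -big_split /=.
  by apply: ler_sum => i _; rewrite mxE le_rnormD.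
by rewrite mulr_sumr; apply: eq_bigr => i _; rewrite mxE rnormM.
Qed.

Lemma coord_le_row_norm a (c : 'rV[R[i]]_a) i : rnorm (c 0 i) <= row_norm c.
Proof.
by rewrite /row_norm (bigD1 i)//= lerDl sumr_ge0// => j _; exact: rnorm_ge0.
Qed.

Lemma geom_complete_row a : geom_complete (@row_norm a) setT.
Proof.
apply: geom_completeW; first exact: row_norm_seminorm.
move=> u M _ uM.
have cE i : exists c, forall n,
    rnorm (c - \sum_(k < n) u k 0 i) <= 4 * M * 2^-1 ^+ n.
  apply: (complex_geometric_limit (u := fun k => u k 0 i)) => k.
  apply: le_trans (uM k).
  exact: coord_le_row_norm.
have [c cP] := boolp.choice cE.
exists (\row_i c i), (\sum_(i < a) 4 * M); split=> // n.
rewrite mulr_suml; apply: ler_sum => i _; rewrite !mxE summxE.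
exact: cP.
Qed.

Section Pairs.
Variables (X : completeNormedModType R[i]) (a : nat).

Definition pair_norm (v : X * 'rV[R[i]]_a) : R := rnorm v.1 + row_norm v.2.

Lemma pair_norm_seminorm : seminorm pair_norm.
Proof.
have [rD rZ] := row_norm_seminorm a.
split=> [x y|c x]; rewrite /pair_norm /=.
  by rewrite addrACA lerD ?le_rnormD.
by rewrite rnormZ rZ mulrDr.
Qed.

Lemma geom_complete_pair (Y : set X) : is_subspace Y -> closed Y ->
  geom_complete pair_norm [set v | Y v.1].
Proof.
move=> sY cY; apply: geom_completeW; first exact: pair_norm_seminorm.
move=> u M Yu uM.
have [//|k|s Ys sP] := geom_complete_closed sY cY (u := fun k => (u k).1) (M := M).
  apply: le_trans (uM k); rewrite lerDl.
  exact: seminorm_ge0 (row_norm_seminorm a).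
have [//|k|c _ cP] := @geom_complete_row a (fun k => (u k).2) M.
  by apply: le_trans (uM k); rewrite lerDr rnorm_ge0.
exists (s, c), (2 * M + 2 * M); split=> // n.
rewrite /pair_norm mulrDl; apply: lerD => /=.
  by rewrite (big_morph (fun p => p.1) (id1 := 0) (op1 := +%R))//; exact: sP.
by rewrite (big_morph (fun p => p.2) (id1 := 0) (op1 := +%R))//; exact: cP.
Qed.
End Pairs.
End Completeness.

(** * Finite-dimensional subspaces *)

Section FiniteDimension.
Variables (R : realType) (X : completeNormedModType R[i]).

Lemma seminorm_lincomb_le (D : lmodType R[i]) (p : D -> R) n (e : 'I_n -> D) M c :
  seminorm p -> (forall i, p (e i) <= M) -> p (lincomb e c) <= M * row_norm c.
Proof.
move=> sp eM; rewrite mulr_sumr /lincomb.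
elim/big_ind2 : _ => [|x y z t xy zt|i _].
- by rewrite seminorm0.
- by apply: le_trans (sp.1 _ _) _; exact: lerD.
- by rewrite sp.2 mulrC ler_wpM2r ?rnorm_ge0.
Qed.

Lemma seminorm_le_sum (D : lmodType R[i]) (p : D -> R) n (e : 'I_n -> D) i :
  seminorm p -> p (e i) <= \sum_j p (e j).
Proof.
move=> sp; rewrite (bigD1 i)//= lerDl sumr_ge0// => j _.
exact: seminorm_ge0.
Qed.

(** By induction on the number of vectors: were the first vector a limit of
combinations of the others, successive approximation would make it such a
combination. *)
Lemma free_coord_bound n (e : 'I_n -> X) : lin_free e ->
  exists2 C, 0 < C & forall c, row_norm c <= C * rnorm (lincomb e c).
Proof.
elim: n e => [|n IHn] e fe.
  exists 1 => // c; rewrite /row_norm big_ord0 mul1r; exact: rnorm_ge0.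
pose e0 := e ord0; pose e' (i : 'I_n) := e (lift ord0 i).
have eE c : lincomb e c = c 0 ord0 *: e0 + lincomb e' (\row_i c 0 (lift ord0 i)).
  rewrite /lincomb big_ord_recl; congr (_ + _).
  by apply: eq_bigr => i _; rewrite mxE.
pose ext t (c : 'rV[R[i]]_n) : 'rV[R[i]]_n.+1 :=
  \row_j (if unlift ord0 j is Some i then c 0 i else t).
have ext0 t c : ext t c 0 ord0 = t by rewrite mxE unlift_none.
have extE t c : lincomb e (ext t c) = t *: e0 + lincomb e' c.
  rewrite eE ext0; congr (_ + lincomb _ _).
  by apply/rowP => i; rewrite !mxE liftK.
have fe' : lin_free e'.
  move=> c c0; have /fe/rowP ec0 : lincomb e (ext 0 c) = 0.
    by rewrite extE c0 scale0r addr0.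
  by apply/rowP => i; have := ec0 (lift ord0 i); rewrite !mxE liftK.
have [C C0 CP] := IHn e' fe'.
have sq := rnorm_seminorm X.
have [d d0 dP] : exists2 d, 0 < d & forall c, d <= rnorm (e0 - lincomb e' c).
  apply: contrapT => nd.
  have close d : 0 < d -> exists c, rnorm (e0 - lincomb e' c) < d.
    move=> d0; apply: contrapT => nc; apply: nd; exists d => // c.
    by rewrite leNgt; apply/negP => cd; apply: nc; exists c.
  have BP c := seminorm_lincomb_le c sq (fun i => seminorm_le_sum e' i sq).
  have B0 : 0 <= \sum_i rnorm (e' i).
    by apply: sumr_ge0 => i _; exact: rnorm_ge0.
  have := @approx_solve R _ _ (@row_norm R n) (@rnorm R X) setT (range (lincomb e))
    (lincomb e') (\sum_i rnorm (e' i)) (C * 2).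
  move=> /(_ (row_norm_seminorm R n) sq (@rnorm0_eq0 _ _)).
  have sW : is_subspace (range (lincomb e)).
    exact: subspace_image (subspaceT _).
  have LW c : [set: 'rV[R[i]]_n] c -> range (lincomb e) (lincomb e' c).
    by move=> _; exists (ext 0 c) => //; rewrite extE scale0r add0r.
  have C20 : 0 <= C * 2 by rewrite mulr_ge0// ltW.
  move=> /(_ sW (@geom_complete_row R n) LW B0 BP C20).
  have appr : forall w, range (lincomb e) w -> exists v, [/\ setT v,
      row_norm v <= C * 2 * rnorm w & rnorm (w - lincomb e' v) <= 2^-1 * rnorm w].
    move=> _ [b _ <-].
    set w := lincomb e b.
    have [w0|w0] := eqVneq w 0.
      by exists 0; rewrite w0 linear0 subr0 !(seminorm0 sq) (seminorm0 (row_norm_seminorm R n)) !mulr0.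
    have wg : 0 < rnorm w by rewrite rnorm_gt0.
    set t := b 0 ord0; set b' := \row_i b 0 (lift ord0 i).
    have [|c cd] := close (rnorm w / (2 * (rnorm t + 1))).
      by rewrite divr_gt0// mulr_gt0// ltr_wpDl// rnorm_ge0.
    have rw : rnorm (w - lincomb e' (t *: c + b')) <= 2^-1 * rnorm w.
      have wE : w = t *: e0 + lincomb e' b' by exact: eE.
      rewrite {1}wE linearD linearZ /= opprD addrACA subrr addr0 -scalerBr rnormZ.
      have t0 := rnorm_ge0 t.
      apply: le_trans (ler_wpM2l t0 (ltW cd)) _.
      have t1 : 0 < 2 * (rnorm t + 1) by lra.
      by rewrite mulrA ler_pdivrMr//; lra.
    exists (t *: c + b'); split=> //.
    apply: le_trans (CP _) _; rewrite -mulrA ler_pM2l//.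
    have := le_rnormD (w - lincomb e' (t *: c + b')) (- w).
    rewrite addrAC subrr add0r !(seminormN _ sq); lra.
  move=> /(_ appr e0)[|v [_ ve _]].
    by exists (ext 1 0) => //; rewrite extE scale1r linear0 addr0.
  have /fe/rowP/(_ ord0) : lincomb e (ext (-1) v) = 0.
    by rewrite extE ve scaleN1r addNr.
  by rewrite ext0 mxE => /eqP; rewrite oppr_eq0 oner_eq0.
exists (d^-1 + C + C * rnorm e0 / d).
  have := rnorm_ge0 e0 => e00.
  apply: ltr_wpDr; last by rewrite addr_gt0// invr_gt0.
  by apply: divr_ge0; [apply: mulr_ge0 => //|]; exact: ltW.
move=> c; set w := lincomb e c.
set t := c 0 ord0; set c' := \row_i c 0 (lift ord0 i).
have wE : w = t *: e0 + lincomb e' c' by exact: eE.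
have td : rnorm t <= rnorm w / d.
  have [->|t0] := eqVneq t 0.
    by rewrite (rnorm_nonneg (lexx 0)) divr_ge0 ?rnorm_ge0// ltW.
  have -> : w = t *: (e0 - lincomb e' (- (t^-1 *: c'))).
    by rewrite wE linearN opprK scalerDr linearZ /= scalerA mulfV// scale1r.
  by rewrite rnormZ ler_pdivlMr// ler_wpM2l ?rnorm_ge0.
have c'w : row_norm c' <= C * (rnorm w + rnorm w / d * rnorm e0).
  apply: le_trans (CP _) _; rewrite ler_pM2l//.
  have -> : lincomb e' c' = w - t *: e0 by rewrite wE addrAC subrr add0r.
  apply: le_trans (le_rnormD _ _) _; rewrite seminormN// rnormZ lerD2l.
  by rewrite ler_wpM2r ?rnorm_ge0.
rewrite /row_norm big_ord_recl.
have -> : \sum_(i < n) rnorm (c 0 (lift ord0 i)) = row_norm c'.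
  by apply: eq_bigr => i _; rewrite mxE.
apply: le_trans (lerD td c'w) _; rewrite le_eqVlt; apply/orP; left; apply/eqP.
by ring.
Qed.
End FiniteDimension.

(** * Stability of the Weyl property *)

Section Perturbation.
Variables (R : realType) (X : completeNormedModType R[i]).
Implicit Types (S : {linear X -> X}) (Y : set X).

Lemma op_shift_is_linear S m : linear (op_shift S m).
Proof.
move=> t u v; rewrite /op_shift linearP scalerDr opprD addrACA scalerBr.
by rewrite !scalerA mulrC.
Qed.

HB.instance Definition _ S m :=
  GRing.isLinear.Build R[i] X X _ (op_shift S m) (op_shift_is_linear S m).

Lemma op_shift_bound S B m x : 
  (forall x, rnorm (S x) <= B * rnorm x) ->
  rnorm (op_shift S m x) <= (B + rnorm m) * rnorm x.
Proof.
move=> SB; rewrite /op_shift mulrDl -rnormZ.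
apply: le_trans (le_rnormD _ _) _; apply: lerD => //.
by rewrite (seminormN _ (rnorm_seminorm X)).
Qed.

Lemma bordered_bound a (S : X -> X) (e : 'I_a -> X) B :
  0 <= B ->
  (forall x, rnorm (S x) <= B * rnorm x) ->
  forall v, rnorm (bordered S e v) <= (B + \sum_i rnorm (e i)) * pair_norm v.
Proof.
move=> B0 SB v; have sq := rnorm_seminorm X.
have E0 : 0 <= \sum_i rnorm (e i).
  by apply: sumr_ge0 => i _; exact: rnorm_ge0.
have le := seminorm_lincomb_le v.2 sq (fun i => seminorm_le_sum e i sq).
apply: le_trans (le_rnormD _ _) _; apply: le_trans (lerD (SB _) le) _.
have v1 := rnorm_ge0 v.1; have v2 := seminorm_ge0 v.2 (row_norm_seminorm R a).
have := mulr_ge0 B0 v2; have := mulr_ge0 E0 v1.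
rewrite /pair_norm mulrDl !mulrDr; lra.
Qed.

Lemma pair_norm0_eq0 a (v : X * 'rV[R[i]]_a) : pair_norm v = 0 -> v = 0.
Proof.
case: v => x c; rewrite /pair_norm /= => v0.
have c0 := seminorm_ge0 c (row_norm_seminorm R a); have x0 := rnorm_ge0 x.
congr pair; first by apply: rnorm0_eq0; lra.
apply/rowP => i; rewrite mxE; apply: rnorm0_eq0.
have := coord_le_row_norm c i; have := rnorm_ge0 (c 0 i); lra.
Qed.

(** Bordering [S] by a complement of its range makes it onto, and the open
mapping theorem applies. *)
Lemma bordered_open S Y B a (e : 'I_a -> X) : 0 <= B ->
  (forall x, rnorm (S x) <= B * rnorm x) ->
  is_subspace Y -> closed Y -> S @` Y `<=` Y -> (forall i, Y (e i)) ->
  (forall v, Y v -> exists c, (S @` Y) (v - \sum_i c i *: e i)) ->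
  exists2 C, 0 < C & forall w, Y w ->
    exists v, [/\ Y v.1, bordered S e v = w & pair_norm v <= C * rnorm w].
Proof.
move=> B0 SB sY cY SY Ye esp; have sq := rnorm_seminorm X.
have V_sub : is_subspace [set v : X * 'rV[R[i]]_a | Y v.1].
  by split=> [|t u v]; [case: sY|exact: (proj2 sY)].
have E0 : 0 <= \sum_i rnorm (e i) by apply: sumr_ge0 => i _; exact: rnorm_ge0.
apply: (open_mapping (@pair_norm_seminorm R X a) sq (@rnorm0_eq0 _ _) V_sub sY
  (geom_complete_pair sY cY) (geom_complete_closed sY cY)
  _ (addr_ge0 B0 E0) (bordered_bound e B0 SB)).
  move=> v Yv; apply: subspaceD => //; last exact: lincomb_in.
  by apply: SY; exists v.1.
move=> w /esp [c [v Yv Sv]]; exists (v, \row_i c i) => //.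
by rewrite /= /bordered /= Sv lincomb_row subrK.
Qed.

(** The bordered operator remains onto for [S - m], and its null space keeps its
dimension: each of its basis vectors for [S] can be corrected by a small vector,
and the corrected vectors span because they do so up to half of the norm. *)
Lemma weyl_on_perturb S Y B : 0 <= B ->
  (forall x, rnorm (S x) <= B * rnorm x) ->
  is_subspace Y -> closed Y -> S @` Y `<=` Y -> weyl_on Y S ->
  exists2 d, 0 < d & forall m, rnorm m < d -> weyl_on Y (op_shift S m).
Proof.
move=> B0 SB sY cY SY /weyl_onP[a [Na [e [Ye esp efr]]]].
have SYY x : Y x -> Y (S x) by move=> Yx; apply: SY; exists x.
have sq := rnorm_seminorm X.
have sp := @pair_norm_seminorm R X a.
have sr := row_norm_seminorm R a.
have V_sub : is_subspace [set v : X * 'rV[R[i]]_a | Y v.1].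
  by split=> [|t u v]; [case: sY|exact: (proj2 sY)].
have Ye_lin c : Y (lincomb e c) by exact: lincomb_in.
have PhiY (A : X -> X) (v : X * 'rV[R[i]]_a) :
    (forall x, Y x -> Y (A x)) -> Y v.1 -> Y (bordered A e v).
  by move=> AY Yv; apply: subspaceD => //; exact: AY.
pose E := \sum_i rnorm (e i).
have E0 : 0 <= E by apply: sumr_ge0 => i _; exact: rnorm_ge0.
have cV := @geom_complete_pair R X a Y sY cY.
have [C C0 solve] := bordered_open B0 SB sY cY SY Ye esp.
have sN := subspaceI sY (subspace_nullspace S).
have /(has_dimP _ sN)[x [Nx xsp xfr]] := Na.
have ker0 v : Y v.1 -> bordered S e v = 0 -> exists t, v = (lincomb x t, 0).
  case: v => v c /= Yv /eqP; rewrite /bordered /= addr_eq0 => /eqP Sv.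
  have c0 : c = 0.
    apply/rowP => i; rewrite mxE; apply: (efr (c 0)); exists (- v).
      exact: subspaceN.
    by rewrite linearN Sv opprK.
  have [|t ->] := xsp v; last by exists t; rewrite c0.
  by split=> //; rewrite /nullspace /= Sv c0 linear0 oppr0.
have [Cx Cx0 CxP] := free_coord_bound xfr.
pose M := \sum_i rnorm (x i).
have M0 : 0 <= M by apply: sumr_ge0 => i _; exact: rnorm_ge0.
have K0 : 0 <= 16 * C * M * Cx by rewrite !mulr_ge0// ltW.
(* The three terms make [m] at most 1, [C * m] at most 1/4, and a combination of
   the corrections [z i] below at most an eighth of that of the [x i]. *)
exists (1 + 4 * C + 16 * C * M * Cx)^-1; first by rewrite invr_gt0; lra.
move=> m; rewrite -[X in _ < X]mul1r ltr_pdivlMr; last by lra.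
have m0 := rnorm_ge0 m; rewrite !mulrDr mulr1 => mlt.
have mC0 : 0 <= rnorm m * C by rewrite mulr_ge0// ltW.
have mK0 : 0 <= rnorm m * C * M * Cx by rewrite !mulr_ge0// ltW.
have m1 : rnorm m <= 1 by lra.
have mC : rnorm m * C <= 4^-1 by lra.
have mK : rnorm m * C * M * Cx <= 16^-1 by lra.
have TmB z : rnorm (op_shift S m z) <= (B + 1) * rnorm z.
  apply: le_trans (op_shift_bound m z SB) _.
  by rewrite ler_wpM2r ?rnorm_ge0// lerD2l.
have B1 : 0 <= B + 1 by lra.
have TmY z : Y z -> Y (op_shift S m z).
  by move=> Yz; apply: subspaceB; [|exact: SYY|exact: subspaceZ].
have Phidiff v : bordered S e v - bordered (op_shift S m) e v = m *: v.1.
  by rewrite /bordered /op_shift opprD addrACA subrr addr0 opprB addrC subrK.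
have solvem w : Y w -> exists v, [/\ Y v.1,
    bordered (op_shift S m) e v = w & pair_norm v <= 2 * C * rnorm w].
  apply: (perturb_solve sp sq (@rnorm0_eq0 _ _) sY cV _ (addr_ge0 B1 E0)
    (bordered_bound e B1 TmB) C0 solve).
    by move=> v; exact: PhiY.
  move=> v _; rewrite Phidiff rnormZ.
  have v1 := rnorm_ge0 v.1; have v2 := seminorm_ge0 v.2 sr.
  have := ler_wpM2r v1 mC; rewrite /pair_norm; lra.
apply: (weyl_on_bordered (e := e)) => //.
- by move=> _ [z Yz <-]; exact: TmY.
- by move=> w /solvem[v [Yv vw _]]; exists v.
have sK : is_subspace [set v : X * 'rV[R[i]]_a |
    Y v.1 /\ bordered (op_shift S m) e v = 0].
  exact: (subspaceI V_sub (subspace_preimage (bordered (op_shift S m) e) (subspace0 X))).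
have zP i : exists z, [/\ Y z.1,
    bordered (op_shift S m) e z = - (m *: x i) &
    pair_norm z <= 2 * C * rnorm m * M].
  have [|z [Yz zE zle]] := solvem (- (m *: x i)).
    by apply: subspaceN => //; apply: subspaceZ => //; case: (Nx i).
  exists z; split=> //; apply: le_trans zle _.
  rewrite seminormN// rnormZ mulrA ler_wpM2l ?seminorm_le_sum//.
  by rewrite mulr_ge0// mulr_ge0// ltW.
have [z zE] := boolp.choice zP.
(* The null vectors [(x i, 0)] of the bordered [S], corrected by [z i], span
   the null space of the bordered [S - m]. *)
pose k i : X * 'rV[R[i]]_a := (x i, 0) - z i.
have kE t : lincomb k t = (lincomb x t, 0) - lincomb z t.
  rewrite /lincomb /k; under eq_bigr do rewrite scalerBr.
  rewrite sumrB; congr (_ - _).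
  rewrite [LHS]surjective_pairing; congr pair.
    by rewrite (big_morph (fun p => p.1) (id1 := 0) (op1 := +%R)).
  rewrite (big_morph (fun p => p.2) (id1 := 0) (op1 := +%R))// big1// => i _.
  by rewrite /= scaler0.
have Kk i : Y (k i).1 /\ bordered (op_shift S m) e (k i) = 0.
  have [Yz zm _] := zE i; have [Yx Sx] := Nx i.
  split; first exact: subspaceB.
  rewrite linearB /= zm opprK /bordered /= linear0 addr0 /op_shift.
  by rewrite (Sx : S (x i) = 0) sub0r addNr.
have pz t : pair_norm (lincomb z t) <= 8^-1 * rnorm (lincomb x t).
  have zM i : pair_norm (z i) <= 2 * C * rnorm m * M by case: (zE i).
  apply: le_trans (seminorm_lincomb_le t sp zM) _.
  have := CxP t; set r := rnorm _ => tr.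
  have r0 : 0 <= r by exact: rnorm_ge0.
  have c0 : 0 <= 2 * C * rnorm m * M by rewrite !mulr_ge0// ltW.
  apply: le_trans (ler_wpM2l c0 tr) _; rewrite mulrA ler_wpM2r//; lra.
have px t : pair_norm (lincomb x t, 0 : 'rV[R[i]]_a) = rnorm (lincomb x t).
  by rewrite /pair_norm /= (seminorm0 sr) addr0.
apply/has_dimP => //; exists k; split=> //; last first.
  move=> t /eqP; rewrite kE subr_eq0 => /eqP xz; apply: xfr; apply: rnorm0_eq0.
  have := pz t; rewrite -xz px; have := rnorm_ge0 (lincomb x t); lra.
move=> u Ku.
have kB t := seminorm_lincomb_le t sp (fun i => seminorm_le_sum k i sp).
have kB0 : 0 <= \sum_i pair_norm (k i).
  by apply: sumr_ge0 => i _; exact: seminorm_ge0.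
have kK t : setT t -> Y (lincomb k t).1 /\ bordered (op_shift S m) e (lincomb k t) = 0.
  by move=> _; exact: (lincomb_in t sK Kk).
have Cx20 : 0 <= 2 * Cx by rewrite mulr_ge0// ltW.
suff appr v : Y v.1 /\ bordered (op_shift S m) e v = 0 -> exists t, [/\ setT t,
    row_norm t <= 2 * Cx * pair_norm v &
    pair_norm (v - lincomb k t) <= 2^-1 * pair_norm v].
  have [t [_ <- _]] := approx_solve sr sp (@pair_norm0_eq0 a) sK
    (@geom_complete_row R a) kK kB0 kB Cx20 appr Ku.
  by exists t.
move=> [Yv Sv].
have [|v' [Yv' Sv' pv']] := solve (m *: v.1); first exact: subspaceZ.
have [||t vt] := ker0 (v - v').
- exact: subspaceB.
- by rewrite linearB /= Sv' -Phidiff /= Sv subr0 subrr.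
have p0 := seminorm_ge0 v sp.
have pv : pair_norm v' <= 4^-1 * pair_norm v.
  apply: le_trans pv' _; rewrite rnormZ mulrA [C * _]mulrC.
  have v1 : rnorm v.1 <= pair_norm v by rewrite lerDl; exact: seminorm_ge0.
  by apply: ler_pM => //; exact: rnorm_ge0.
have xt : rnorm (lincomb x t) <= pair_norm v + pair_norm v'.
  by rewrite -px -vt; apply: le_trans (sp.1 _ _) _; rewrite seminormN.
exists t; split=> //.
  apply: le_trans (CxP t) _; rewrite [2 * _]mulrC -mulrA ler_pM2l//.
  lra.
have -> : v - lincomb k t = v' + lincomb z t.
  by rewrite kE -vt !opprB addrCA [v + _]addrCA subrr addr0 addrC.
apply: le_trans (sp.1 _ _) _; have := pz t; lra.
Qed.
End Perturbation.

(** * Closed ranges and bounded inverses *)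

Section BoundedOperators.
Variables (R : realType) (X : completeNormedModType R[i]).
Implicit Types (S : {linear X -> X}) (Y : set X).

Lemma continuous_rnorm_bound S : continuous S ->
  exists2 B, 0 <= B & forall x, rnorm (S x) <= B * rnorm x.
Proof.
move=> /linear_bounded_continuous/linear_boundedP/pinfty_ex_gt0[r r0 Sr].
have [B B0 rE] := complex_pos_real r0; exists B; first exact: ltW.
by move=> x; rewrite -lecR rmorphM /= !rnormE -rE.
Qed.

Lemma rnorm_bound_continuous S (B : R) :
  (forall x, rnorm (S x) <= B * rnorm x) -> continuous S.
Proof.
move=> SB; apply/linear_bounded_continuous/linear_boundedP.
exists B%:C; split; first by rewrite realE -[0]/(0%:C) !lecR le_total.
move=> r Br x; apply: (@le_trans _ _ (B%:C * `|x|)).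
  by rewrite -!rnormE -rmorphM lecR.
by rewrite ler_wpM2r// ltW.
Qed.

Lemma closed_rnorm (A : set X) :
  (forall w, (forall r, 0 < r -> exists2 w', A w' & rnorm (w - w') < r) -> A w) ->
  closed A.
Proof.
move=> H w cw; apply: H => r r0.
have r0' : 0 < r%:C :> R[i] by rewrite ltcR.
have [w' [Aw' ]] := cw _ (nbhsx_ballx w _ r0').
rewrite -ball_normE /ball_ /= => ww'; exists w' => //.
by rewrite -ltcR rnormE.
Qed.

Lemma closed_approx (A : set X) w : closed A ->
  (forall r, 0 < r -> exists2 w', A w' & rnorm (w - w') < r) -> A w.
Proof.
move=> cA H; apply: cA => U /nbhs_ballP[_ /= /complex_pos_real[r r0 ->] wU].
have [w' Aw' ww'] := H r r0; exists w'; split=> //; apply: wU.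
by rewrite -ball_normE /ball_ /= -rnormE ltcR.
Qed.

(** The coordinates of [w] in a complement of the range are bounded by the norm
of [w], so they vanish at limits of vectors of the range. *)
Lemma closed_image_findim S Y B b : 0 <= B ->
  (forall x, rnorm (S x) <= B * rnorm x) ->
  is_subspace Y -> closed Y -> S @` Y `<=` Y ->
  dim_quotient Y (S @` Y) b -> closed (S @` Y).
Proof.
move=> B0 SB sY cY SY [e [Ye esp efr]].
have [C C0 solve] := bordered_open B0 SB sY cY SY Ye esp.
have sSY := subspace_image S sY.
apply: closed_rnorm => w wlim.
have Yw : Y w.
  by apply: closed_approx => // r /wlim[w' /SY Yw' ww']; exists w'.
have [[v c] /= [Yv vw _]] := solve w Yw.
suff c0 : c = 0 by exists v => //; rewrite -vw /bordered c0 linear0 addr0.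
suff c0 : row_norm c = 0.
  apply/rowP => i; rewrite mxE; apply: rnorm0_eq0.
  have := coord_le_row_norm c i; rewrite c0 => ci.
  by apply/eqP; rewrite eq_le ci rnorm_ge0.
apply/eqP; rewrite eq_le (seminorm_ge0 _ (row_norm_seminorm R b)) andbT.
apply/ler_addgt0Pr => r r0; rewrite add0r.
have rC : 0 < r / C by rewrite divr_gt0.
have [w' [y Yy yw'] ww'] := wlim _ rC.
have Yw' : Y w' by apply: SY; exists y.
have [[v' c'] /= [Yv' vw' p']] := solve (w - w') (subspaceB sY Yw Yw').
have cc' : c = c'.
  apply/rowP => i; apply/eqP; rewrite -subr_eq0; apply/eqP.
  apply: (efr (fun i => c 0 i - c' 0 i)).
  exists (v' - (v - y)); first by do ?apply: subspaceB.
  under eq_bigr do rewrite scalerBl.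
  rewrite sumrB; move: vw vw'; rewrite /bordered /= => vw vw'.
  rewrite linearB /= [S (v - y)]linearB /= yw' -/(lincomb e c) -/(lincomb e c').
  have -> : S v' = w - w' - lincomb e c' by rewrite -vw' addrK.
  have -> : S v = w - lincomb e c by rewrite -vw addrK.
  by rewrite [w - _ - w']addrAC opprB [LHS]addrC addrA subrK.
rewrite cc'; apply: le_trans (_ : pair_norm (v', c') <= _); last first.
  by apply: le_trans p' _; rewrite mulrC -ler_pdivlMr// ltW.
by rewrite lerDr rnorm_ge0.
Qed.

(** The bounded inverse theorem. *)
Lemma invertible_of_bijective S : continuous S ->
  (forall x, S x = 0 -> x = 0) -> (forall y, exists x, S x = y) ->
  invertible_op S.
Proof.
move=> /continuous_rnorm_bound[B B0 SB] inj surj.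
have cT := geom_complete_closed (subspaceT X) closedT.
have [C C0 solve] : exists2 C, 0 < C & forall w, setT w ->
    exists v, [/\ setT v, S v = w & rnorm v <= C * rnorm w].
  apply: (open_mapping (rnorm_seminorm X) (rnorm_seminorm X)
    (@rnorm0_eq0 _ _) (subspaceT X) (subspaceT X) cT cT _ B0 SB) => //.
  by move=> w _; have [x] := surj w; exists x.
have solve' w : exists v, S v = w /\ rnorm v <= C * rnorm w.
  by have [//|v [_ ? ?]] := solve w; exists v.
have [g gP] := boolp.choice solve'.
have SK : cancel S g.
  move=> x; apply/eqP; rewrite -subr_eq0; apply/eqP/inj.
  by rewrite linearB; case: (gP (S x)) => -> _; rewrite subrr.
have gK : cancel g S by move=> y; case: (gP y).
have glin : linear g.
  move=> t u v; rewrite -[in LHS](gK u) -[in LHS](gK v) -linearP.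
  exact: SK.
pose G : {linear X -> X} := HB.pack g (GRing.isLinear.Build R[i] X X _ g glin).
exists G; split=> //; apply: (rnorm_bound_continuous (B := C)) => x.
by case: (gP x).
Qed.

Lemma bounded_below_invertible S : invertible_op S -> bounded_below S.
Proof.
move=> [G [/continuous_rnorm_bound[B B0 GB] SK _]].
exists ((B + 1)^-1)%:C; first by rewrite ltcR invr_gt0 ltr_wpDl.
move=> x; rewrite -!rnormE -rmorphM lecR ler_pdivrMl ?ltr_wpDl//.
rewrite -[in leLHS](SK x); apply: le_trans (GB _) _.
by rewrite ler_wpM2r ?rnorm_ge0// lerDl.
Qed.

Lemma bounded_below_inj S x : bounded_below S -> S x = 0 -> x = 0.
Proof.
move=> [c c0 cS] Sx; apply/eqP; rewrite -normr_eq0 eq_le normr_ge0 andbT.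
by rewrite -(ler_pM2l c0) mulr0 -(normr0 X) -Sx.
Qed.

Lemma range_iterS S k : range (iter k.+1 S) = S @` range (iter k S).
Proof.
apply/seteqP; split=> [_ [x _ <-]|_ [_ [x _ <-] <-]]; last by exists x.
by exists (iter k S x) => //; exists x.
Qed.

Lemma subspace_range_iter S k : is_subspace (range (iter k S)).
Proof.
elim: k => [|k IHk]; last by rewrite range_iterS; exact: subspace_image.
by rewrite (_ : range _ = setT) // -subTset => x _; exists x.
Qed.

Lemma range_iter0 S : range (iter 0 S) = setT.
Proof. by rewrite -subTset => x _; exists x. Qed.

Lemma range_iter_sub S k : S @` range (iter k S) `<=` range (iter k S).
Proof. by move=> _ [_ [x _ <-] <-]; exists (S x) => //; rewrite -iterSr. Qed.

Lemma range_iter_decr S j k : (j <= k)%N ->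
  range (iter k S) `<=` range (iter j S).
Proof.
move=> /subnKC <-; elim: (k - j)%N => [|i IHi]; first by rewrite addn0.
rewrite addnS range_iterS; apply: subset_trans IHi; exact: range_iter_sub.
Qed.
End BoundedOperators.

(** * B-Weyl operators near the origin *)

Section Bweyl.
Variables (R : realType) (X : completeNormedModType R[i]).
Implicit Types (S : {linear X -> X}).

(** Perturbation takes place on the closed range of [S ^ n], and [m != 0] brings
the Weyl property back to the whole space one power at a time. *)
Lemma Bweyl_punctured_weyl S : continuous S -> Bweyl S ->
  exists2 d, 0 < d & forall m, 0 < rnorm m -> rnorm m < d ->
    weyl (op_shift S m).
Proof.
move=> /continuous_rnorm_bound[B B0 SB] [n [cn wn]].
have sn := subspace_range_iter S.
have [d d0 dP] := weyl_on_perturb B0 SB (sn n) cn (@range_iter_sub _ _ S n) wn.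
exists d => // m; rewrite rnorm_gt0 => m0 md.
have {dP} := dP m md.
elim: n {cn wn} => [|n IHn]; first by rewrite range_iter0.
rewrite range_iterS => wn; apply: IHn.
apply: (weyl_on_image m0 (sn n)) wn => //; exact: range_iter_sub.
Qed.

Lemma Bweyl_finite_nullity S : Bweyl S -> finite_dim (nullspace S) -> weyl S.
Proof.
move=> [n [_ wn]] fN.
elim: n wn => [|n IHn]; first by rewrite range_iter0.
rewrite range_iterS => wn; apply: IHn.
apply: weyl_on_preimage wn.
- exact: subspace_range_iter.
- exact: range_iter_sub.
- rewrite setIC; apply: finite_dim_sub => //; first exact: subspace_nullspace.
  exact: subspace_range_iter.
Qed.

(** On the range of [S ^ n], injective and Weyl imply onto; injectivity of [S ^ n]
cancels the powers. *)
Lemma Bweyl_inj_surj S : Bweyl S -> (forall x, S x = 0 -> x = 0) ->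
  forall y, exists x, S x = y.
Proof.
move=> [n [_ wn]] inj y.
have N0 : range (iter n S) `&` nullspace S `<=` [set 0].
  by move=> x [_]; exact: inj.
have Ry : range (iter n S) (iter n S y) by exists y.
have [_ [x _ <-]] := weyl_on_inj (subspace_range_iter S n) wn N0 Ry.
rewrite -iterS iterSr => E; exists x.
elim: n E {wn N0 Ry} => //= n IHn E; apply: IHn.
by apply/eqP; rewrite -subr_eq0; apply/eqP/inj; rewrite linearB E subrr.
Qed.

Lemma eigenvector_in_range S m x k : m != 0 -> S x = m *: x ->
  range (iter k S) x.
Proof.
move=> m0 Sx; have sR := subspace_range_iter S.
elim: k => [|k IHk]; first by exists x.
rewrite range_iterS; exists (m^-1 *: x); first exact: subspaceZ.
by rewrite linearZ /= Sx scalerA mulVf// scale1r.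
Qed.

(** These null spaces decrease inside a finite-dimensional space; [m] is where
their dimension is least. *)
Lemma nullspace_range_stable S n :
  finite_dim (range (iter n S) `&` nullspace S) ->
  exists2 m, (n <= m)%N & forall k,
    range (iter m S) `&` nullspace S `<=` range (iter k S).
Proof.
move=> [a Na]; have sR := subspace_range_iter S.
have /(has_dimP _ (subspaceI (sR n) (subspace_nullspace S)))[x [Nx xsp xfr]] := Na.
have [M ME] := boolp.choice (fun k => subspace_coords x (sR (n + k)%N)).
have Mdecr j k : (j <= k)%N -> (M k <= M j)%MS.
  move=> jk; apply/rV_subP => c /(ME k) Rc; apply/(ME j).
  by apply: range_iter_decr Rc; rewrite leq_add2l.
have exr : exists r, `[< exists k, \rank (M k) = r >].
  by exists (\rank (M 0%N)); apply/asboolP; exists 0%N.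
case: (ex_minnP exr) => _ /asboolP[k <-] kmin.
exists (n + k)%N; first exact: leq_addr.
move=> j y [Ry Sy].
have [|c yE] := xsp y.
  by split=> //; apply: range_iter_decr Ry; exact: leq_addr.
have [jk|kj] := leqP j (n + k); first exact: range_iter_decr Ry.
have nj : (n <= j)%N := leq_trans (leq_addr k n) (ltnW kj).
have kj' : (k <= j - n)%N by rewrite leq_subRL//; exact: ltnW.
rewrite -(subnKC nj) yE; apply/ME.
apply: (@submx_trans _ _ _ _ _ _ (M k)); first by apply/ME; rewrite -yE.
have := mxrank_leqif_sup (Mdecr _ _ kj').
move=> [_ <-]; rewrite eqn_leq mxrankS ?Mdecr//=.
by apply: kmin; apply/asboolP; exists (j - n)%N.
Qed.

Lemma closed_range_iter S n : continuous S -> closed (range (iter n S)) ->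
  (exists b, dim_quotient (range (iter n S)) (range (iter n.+1 S)) b) ->
  forall k, (n <= k)%N -> closed (range (iter k S)).
Proof.
move=> /continuous_rnorm_bound[B B0 SB] cn bn k /subnKC <-.
have sR := subspace_range_iter S.
suff [] : closed (range (iter (n + (k - n)) S)) /\
  exists b, dim_quotient (range (iter (n + (k - n)) S))
                         (range (iter (n + (k - n)).+1 S)) b by [].
elim: (k - n)%N => [|i [ci [b bi]]]; first by rewrite addn0.
rewrite addnS; split.
  rewrite range_iterS in bi *.
  exact: (closed_image_findim B0 SB (sR _) ci (@range_iter_sub _ _ S _) bi).
apply: (dim_quotient_image (f := S) _ _ _ _ _ bi) => //.
- by move=> v Rv; rewrite range_iterS; exists v.
- by move=> v; rewrite range_iterS => -[u Ru <-]; exists u.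
- by move=> v Rv; rewrite range_iterS; exists v.
Qed.

(** The alternative is decided by whether the null space of [S] meets the
intersection [Xoo] of the ranges of the powers of [S]. Eigenvectors for nonzero
eigenvalues lie in [Xoo]. If the null space misses [Xoo], it misses the range of
some [S ^ m], where [S] is then bounded below. Otherwise, [S] maps [Xoo] onto
itself with a bound on preimages, so [S - l] is onto as well, and a vector of
the null space can be corrected into an eigenvector. *)
Lemma punctured_dichotomy S : continuous S -> Bweyl S ->
  (exists2 d, 0 < d & forall m, 0 < rnorm m -> rnorm m < d ->
     forall x, op_shift S m x = 0 -> x = 0) \/
  (exists2 d, 0 < d & forall m, rnorm m < d ->
     exists2 x, x != 0 & op_shift S m x = 0).
Proof.
move=> cS [n [cn /weyl_onP[a [Na Ra]]]].
have sR := subspace_range_iter S.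
have [m nm mst] : exists2 m, (n <= m)%N & forall k,
    range (iter m S) `&` nullspace S `<=` range (iter k S).
  by apply: nullspace_range_stable; exists a.
have cR k : (n <= k)%N -> closed (range (iter k S)).
  by apply: closed_range_iter => //; exists a; rewrite range_iterS.
have [B B0 SB] := continuous_rnorm_bound cS.
have sq := rnorm_seminorm X.
have [C C0 solve] : exists2 C, 0 < C & forall w, range (iter m.+1 S) w ->
    exists v, [/\ range (iter m S) v, S v = w & rnorm v <= C * rnorm w].
  apply: (open_mapping sq sq (@rnorm0_eq0 _ _) (sR m) (sR m.+1)
    (geom_complete_closed (sR m) (cR m nm)) (geom_complete_closed (sR m.+1) _)
    _ B0 SB) => //.
  - by apply: cR; rewrite (leq_trans nm).
  - by move=> v Rv; rewrite range_iterS; exists v.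
  - by move=> w; rewrite range_iterS => -[v Rv <-]; exists v.
have C20 : 0 < (2 * C)^-1 by rewrite invr_gt0 mulr_gt0.
have [triv|/existsNP[x0 /not_implyP[[Rx0 Sx0] x00]]] := pselect (forall x,
    (range (iter m S) `&` nullspace S) x -> x = 0); [left|right].
- exists (2 * C)^-1 => // l l0; rewrite -[X in _ < X]mul1r ltr_pdivlMr ?mulr_gt0// => lC.
  move=> x /eqP; rewrite subr_eq0 => /eqP Sx.
  have ln0 : l != 0 by rewrite -rnorm_gt0.
  have Rx k := eigenvector_in_range k ln0 Sx.
  have [|v [Rv Sv vx]] := solve (S x); first by rewrite range_iterS; exists x.
  have xv : x = v.
    apply/eqP; rewrite -subr_eq0; apply/eqP/triv; split; first exact: subspaceB.
    by rewrite /nullspace /= linearB Sv subrr.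
  apply: rnorm0_eq0; move: vx; rewrite -xv Sx rnormZ.
  have := rnorm_ge0 x; set r := rnorm x => r0.
  move=> rle; apply/eqP; rewrite eq_le r0 andbT leNgt; apply/negP => rp.
  have : rnorm l * (2 * C) * r < r by rewrite gtr_pMl.
  lra.
- pose Xoo : set X := \bigcap_k range (iter (m + k) S).
  have sXoo : is_subspace Xoo.
    split; first by move=> k _; case: (sR (m + k)%N).
    by move=> t u v Xu Xv k kT; apply: (proj2 (sR _)); [exact: Xu|exact: Xv].
  have cXoo : closed Xoo.
    by apply: closed_bigI => k _; apply: cR; rewrite (leq_trans nm)// leq_addr.
  have SXoo v : Xoo v -> Xoo (S v).
    by move=> Xv k kT; apply: range_iter_sub; exists v => //; exact: Xv.
  have Xx0 : Xoo x0 by move=> k _; exact: mst.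
  have solveoo w : Xoo w -> exists v, [/\ Xoo v, S v = w & rnorm v <= C * rnorm w].
    move=> Xw; have [|v [Rv Sv vw]] := solve w.
      by have := Xw 1%N I; rewrite addn1.
    exists v; split=> // k _.
    have := Xw k.+1 I; rewrite addnS range_iterS => -[y Ry Sy].
    rewrite -(subrK y v); apply: subspaceD => //; apply: mst.
    split; last by rewrite /nullspace /= linearB Sv Sy subrr.
    by apply: subspaceB => //; apply: range_iter_decr Ry; exact: leq_addr.
  exists (2 * C)^-1 => // l.
  rewrite -[X in _ < X]mul1r ltr_pdivlMr ?mulr_gt0// => lC.
  have [||z [_ Sz zx]] := perturb_solve (L := S) (L' := op_shift S l) sq sq
    (@rnorm0_eq0 _ _) sXoo (geom_complete_closed sXoo cXoo) _ (addr_ge0 B0 (rnorm_ge0 l))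
    (fun v => op_shift_bound l v SB) C0 solveoo _ (subspaceN sXoo (subspaceZ l sXoo Xx0)).
  + by move=> v Xv; exact: (subspaceB sXoo (SXoo _ Xv) (subspaceZ l sXoo Xv)).
  + move=> v _; rewrite /op_shift opprB addrC subrK rnormZ mulrA ler_piMl ?rnorm_ge0//.
    by rewrite mulrC ltW.
  have x0g : 0 < rnorm x0 by rewrite rnorm_gt0; apply/eqP.
  exists (x0 - z); last first.
    by rewrite linearB /= Sz opprK /op_shift (Sx0 : S x0 = 0) sub0r addNr.
  rewrite subr_eq0; apply/eqP => xz.
  move: zx; rewrite -xz seminormN// rnormZ mulrA leNgt => /negP; apply.
  by rewrite gtr_pMl// mulrC.
Qed.
End Bweyl.

(** * Spectral sets *)

Section SpectralSets.
Variables (R : realType) (X : completeNormedModType R[i]).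
Implicit Types (T : {linear X -> X}).

Lemma isoP (A : set R[i]) l : iso A l <-> A l /\
  exists2 d, 0 < d & forall m, 0 < rnorm m -> rnorm m < d -> ~ A (l + m).
Proof.
split.
- move=> [/set_mem Al [V /nbhs_ballP[_ /= /complex_pos_real[r r0 ->] lV] VA]].
  split=> //; exists r => // m m0 mr Alm.
  have : (V `&` A) (l + m).
    split=> //; apply: lV; rewrite -ball_normE /ball_ /= opprD addNKr normrN.
    by rewrite -rnormE ltcR.
  rewrite VA => /= /eqP; rewrite -subr_eq0 addrAC subrr add0r.
  by move=> me0; move: m0; rewrite rnorm_gt0 me0.
- move=> [Al [d d0 dA]]; split; first exact: mem_set.
  exists (ball (l : R[i]^o) d%:C); first by apply: nbhsx_ballx; rewrite ltcR.
  apply/seteqP; split=> [z [zl Az]|_ ->]; last first.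
    by split=> //; apply: ballxx; rewrite ltcR.
  apply: contrapT => /eqP zl'; apply: (dA (z - l)); last by rewrite addrC subrK.
    by rewrite rnorm_gt0 subr_eq0.
  move: zl; rewrite -ball_normE /ball_ /= distrC.
  by rewrite -[X in X < _]rnormE ltcR.
Qed.

Lemma op_shiftD T l m : op_shift T (l + m) = op_shift (op_shift T l) m.
Proof. by apply/funext => x; rewrite /op_shift scalerDl opprD addrA. Qed.

Lemma op_shift_continuous T l : continuous T -> continuous (op_shift T l).
Proof.
move=> /continuous_rnorm_bound[B _ TB].
by apply: rnorm_bound_continuous => x; exact: op_shift_bound.
Qed.

Lemma eigenvaluesP T l :
  eigenvalues T l <-> exists2 x, x != 0 & op_shift T l x = 0.
Proof.
split=> -[x x0 Tx]; exists x => //; first by rewrite /op_shift Tx subrr.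
by apply/eqP; rewrite -subr_eq0; apply/eqP.
Qed.

Lemma not_eigenvalue_inj T l : ~ eigenvalues T l ->
  forall x, op_shift T l x = 0 -> x = 0.
Proof.
move=> nE x Tx; apply: contrapT => /eqP x0; apply: nE.
by apply/eigenvaluesP; exists x.
Qed.

Lemma eigenvalue_approx_point T l :
  eigenvalues T l -> approx_point_spectrum T l.
Proof.
move=> /eigenvaluesP[x x0 Tx] bb; move: x0.
by rewrite (bounded_below_inj bb Tx) eqxx.
Qed.

Lemma approx_point_sub_spectrum T : approx_point_spectrum T `<=` spectrum T.
Proof. by move=> l nb /bounded_below_invertible. Qed.

Lemma weyl_Bweyl (S : {linear X -> X}) : weyl S -> Bweyl S.
Proof.
by move=> wS; exists 0%N; rewrite range_iter0; split=> //; exact: closedT.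
Qed.

Lemma invertible_weyl (S : {linear X -> X}) : invertible_op S -> weyl S.
Proof.
move=> [G [_ SK GK]]; apply/weyl_onP; exists 0%N.
split; exists (fun=> 0); split=> [[]//| |c _ []//].
- move=> v [_ Sv]; exists (fun=> 0); rewrite big_ord0 subr0 /=.
  by rewrite -(SK v) (Sv : S v = 0) linear0.
- by move=> v _; exists (fun=> 0); rewrite big_ord0 subr0; exists (G v); rewrite ?GK.
Qed.

Lemma Bweyl_spectrum_sub T : Bweyl_spectrum T `<=` weyl_spectrum T.
Proof. by move=> l nB /weyl_Bweyl. Qed.

Lemma Bweyl_eigenvalue T l : continuous T -> Bweyl (op_shift T l) ->
  spectrum T l -> eigenvalues T l.
Proof.
move=> cT Bl sl; apply: contrapT => /not_eigenvalue_inj inj; apply: sl.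
apply: invertible_of_bijective => //; first exact: op_shift_continuous.
exact: Bweyl_inj_surj.
Qed.

Lemma eigenvalues_fin_sub T : eigenvalues_fin T `<=` eigenvalues T.
Proof.
move=> l [[//|n] _ /(has_dimP _ (subspace_nullspace _))[e [Ne _ fe]]].
apply/eigenvaluesP; exists (e ord0); last exact: Ne.
apply/eqP => e0; have /fe/rowP/(_ ord0) : lincomb e (delta_mx 0 ord0) = 0.
  rewrite /lincomb big_ord_recl e0 scaler0 add0r big1// => i _.
  by rewrite mxE scale0r.
by rewrite !mxE !eqxx => /eqP; rewrite oner_eq0.
Qed.

Lemma Ea0_sub_Ea T : Ea0 T `<=` Ea T.
Proof. by move=> l [il /eigenvalues_fin_sub]. Qed.

Lemma weyl_eigenvalues_fin T l :
  weyl (op_shift T l) -> eigenvalues T l -> eigenvalues_fin T l.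
Proof.
move=> /weyl_onP[n [Nn _]] /eigenvaluesP[x x0 Tx]; exists n; last first.
  by rewrite setTI in Nn.
have sN := subspaceI (subspaceT X) (subspace_nullspace (op_shift T l)).
case: n Nn => // /(has_dimP _ sN)[e [_ sp _]].
have [//|c xE] := sp x; move: x0; rewrite xE /lincomb big_ord0 eqxx.
by [].
Qed.

Lemma ZEa_Ea_eq T : property_ZEa T -> Ea T = Ea0 T.
Proof.
move=> Z; apply/seteqP; split; last exact: Ea0_sub_Ea.
move=> l El; have : (spectrum T `\` weyl_spectrum T) l by rewrite Z.
move: El => [il el] [_ /contrapT wl]; split=> //.
exact: weyl_eigenvalues_fin.
Qed.

(** The point [l] is isolated in the approximate point spectrum: for small
nonzero [m], the operator [T - (l + m)] is Weyl, so either it is invertible, or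
[l + m] belongs to [Ea] and is isolated, which is impossible when all the points
close to [l] are eigenvalues. *)
Lemma ZEa_Bweyl_Ea T : continuous T -> property_ZEa T ->
  spectrum T `\` Bweyl_spectrum T `<=` Ea T.
Proof.
move=> cT Z l [sl /contrapT Bl].
have el := Bweyl_eigenvalue cT Bl sl; split=> //.
have cTl := op_shift_continuous (l := l) cT.
apply/isoP; split; first exact: eigenvalue_approx_point.
have [d1 d10 W] := Bweyl_punctured_weyl cTl Bl.
have [[d2 d20 inj]|[d2 d20 eig]] := punctured_dichotomy cTl Bl.
  exists (Num.min d1 d2); first by rewrite lt_min d10.
  move=> m m0; rewrite lt_min => /andP[md1 md2]; apply.
  rewrite op_shiftD; apply: bounded_below_invertible.
  apply: invertible_of_bijective; first exact: op_shift_continuous.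
    exact: inj.
  apply: Bweyl_inj_surj; last exact: inj.
  by apply: weyl_Bweyl; exact: W.
pose r := Num.min d1 d2 / 2.
have dm : 0 < Num.min d1 d2 by rewrite lt_min d10.
have r0 : 0 < r by rewrite divr_gt0.
have rd : r < Num.min d1 d2 by rewrite /r; lra.
move: rd; rewrite lt_min => /andP[rd1 rd2].
have rr : rnorm r%:C = r by rewrite rnorm_nonneg// ltW.
have eigP m : rnorm m < d2 -> eigenvalues T (l + m).
  by move=> md; apply/eigenvaluesP; rewrite op_shiftD; exact: eig.
have [] : Ea T (l + r%:C).
  rewrite -Z; split.
    apply: approx_point_sub_spectrum; apply: eigenvalue_approx_point.
    by apply: eigP; rewrite rr.
  by move=> []; rewrite op_shiftD; apply: W; rewrite rr.
move=> /isoP[_ [d d0 dP]] _.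
pose s := Num.min d (d2 - r) / 2.
have sm : 0 < Num.min d (d2 - r) by rewrite lt_min d0 subr_gt0.
have s0 : 0 < s by rewrite divr_gt0.
have sd : s < Num.min d (d2 - r) by rewrite /s; lra.
move: sd; rewrite lt_min => /andP[sd1 sd2].
have ss : rnorm s%:C = s by rewrite rnorm_nonneg// ltW.
exfalso; apply: (dP s%:C); rewrite ?ss//.
apply: eigenvalue_approx_point; rewrite -addrA; apply: eigP.
rewrite -rmorphD rnorm_nonneg ?addr_ge0 ?ltW//; lra.
Qed.
End SpectralSets.

Theorem theorem2p7 (R : realType) (X : completeNormedModType R[i])
    (X_infinite_dim : ~ finite_dim [set: X])
    (T : {linear X -> X}) (T_bounded : continuous T) :
  [/\ property_ZEa T <->
        property_gaw T /\ Bweyl_spectrum T = weyl_spectrum T,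
      property_ZEa T <-> property_aw T /\ Ea T = Ea0 T
    & property_ZEa T <-> property_Baw T /\ Ea T = Ea0 T].
Proof.
have Zsub := Bweyl_spectrum_sub (T := T).
have ZB : property_ZEa T -> Bweyl_spectrum T = weyl_spectrum T.
  move=> Z; apply/seteqP; split=> // l wl Bl.
  have [il|sl] := pselect (invertible_op (op_shift T l)).
    exact/wl/invertible_weyl.
  have : (spectrum T `\` weyl_spectrum T) l.
    by rewrite Z; apply: ZEa_Bweyl_Ea => //; split=> // ; apply.
  by move=> [_]; apply.
split; split.
- by move=> Z; split; [rewrite /property_gaw ZB|exact: ZB].
- by move=> [G E]; rewrite /property_ZEa -E.
- by move=> Z; have E := ZEa_Ea_eq Z; split=> //; rewrite /property_aw -E.
- by move=> [G E]; rewrite /property_ZEa E.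
- by move=> Z; have E := ZEa_Ea_eq Z; split=> //; rewrite /property_Baw ZB// -E.
- move=> [G E]; rewrite /property_ZEa E -G.
  apply/seteqP; split=> l [sl wl]; split=> //; first by move=> /Zsub.
  move=> nw; apply: nw; apply: Bweyl_finite_nullity; first exact: contrapT.
  have : (spectrum T `\` Bweyl_spectrum T) l by [].
  by rewrite G => -[_ [k _ Nk]]; exists k.
Qed.
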